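(* Let $K$ be a field and let $(X,\sigma)$ be a Deaconu--Renault system with $X$ totally disconnected. Assume that the Steinberg algebra $A_K(G(X,\sigma))$ is infinite-dimensional and that the points of $X\setminus\operatorname{dom}(\sigma)$ are all isolated in $X$. Consider $A_K(G(X,\sigma))$ with its natural $\mathbb Z$-grading. Then the following are equivalent: (1) $A_K(G(X,\sigma))$ is graded just infinite; (2) $A_K(G(X,\sigma))$ is graded simple; (3) $G(X,\sigma)$ is minimal.
   Context: A Deaconu--Renault system is a pair $(X,\sigma)$ where $X$ is a locally compact Hausdorff space and $\sigma:\operatorname{dom}(\sigma)\to X$ is a local homeomorphism defined on an open subset $\operatorname{dom}(\sigma)\subseteq X$. Set $\operatorname{dom}(\sigma^0)=X$, $\sigma^0=\mathrm{id}_X$, $\operatorname{dom}(\sigma^{n+1})=\{x\in\operatorname{dom}(\sigma^n):\sigma^n(x)\in\operatorname{dom}(\sigma)\}$ and $\sigma^{n+1}(x)=\sigma(\sigma^n(x))$. The Deaconu--Renault groupoid is $G(X,\sigma)=\{(x,k,y)\in X\times\mathbb Z\times X:\exists\, m,n\ge0,\ k=m-n,\ x\in\operatorname{dom}(\sigma^m),\ y\in\operatorname{dom}(\sigma^n),\ \sigma^m(x)=\sigma^n(y)\}$, with $r(x,k,y)=x$, $s(x,k,y)=y$, $(x,k,y)(y,\ell,z)=(x,k+\ell,z)$, $(x,k,y)^{-1}=(y,-k,x)$, unit space identified with $X$ via $x\leftrightarrow(x,0,x)$, and topology generated by the sets $Z(U,m,n,V)=\{(x,m-n,y): x\in U,\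 y\in V,\ \sigma^m(x)=\sigma^n(y)\}$, with $m,n\ge0$ and $U\subseteq\operatorname{dom}(\sigma^m)$, $V\subseteq\operatorname{dom}(\sigma^n)$ open such that $\sigma^m|_U$, $\sigma^n|_V$ are homeomorphisms onto their images. When $X$ is totally disconnected this is an ample Hausdorff groupoid. The orbit of $u\in X$ is $\{r(\gamma):\gamma\in G(X,\sigma),\ s(\gamma)=u\}$; the groupoid is minimal if every orbit is dense in $X$. The Steinberg algebra of an ample Hausdorff groupoid $G$ is $A_K(G)=\mathrm{span}_K\{1_U:U\subseteq G\text{ a compact open bisection}\}$ with convolution product, determined by $1_U*1_V=1_{UV}$ (a bisection is a set on which $r$ and $s$ are injective). The natural $\mathbb Z$-grading of $A_K(G(X,\sigma))$ is induced by $c(x,k,y)=k$: the degree-$k$ component is $\mathrm{span}_K\{1_U:U\subseteq c^{-1}(k)\text{ a compact open bisection}\}$. A graded ideal of $A=\bigoplus_k A_k$ is an ideal $I$ with $I=\bigoplus_k(A_k\cap I)$; $A$ is graded just infinite if $\dim_K A=\infty$ and $\dim_K A/J<\infty$ for every nonzero graded ideal $J$; $A$ is graded simple if its only graded ideals are $0$ and $A$. *)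

(* Defs.v *)
From HB Require Import structures.
From mathcomp Require Import all_boot all_order all_algebra.
From mathcomp Require Import all_classical topology numfun.
From mathcomp Require Import zify.

Set Implicit Arguments.
Unset Strict Implicit.
Unset Printing Implicit Defensive.
Import Order.TTheory GRing.Theory Num.Theory.
Local Open Scope classical_set_scope.
Local Open Scope ring_scope.

(** A K-algebra, possibly without unit, is represented by a linear subspace [A]
    of an ambient K-vector space [V], together with a product [mul] on [V]
    under which [A] is stable; a grading is a family [Ak] of subspaces of [A]
    whose direct sum is [A]. *)
Section GradedAlgebra.
Variables (K : fieldType) (V : lmodType K).
Implicit Types (S I J : set V) (F : int -> set V).

Definition lspan S : set V :=
  [set v | exists n (a : 'I_n -> K) (w : 'I_n -> V),
     (forall i, S (w i)) /\ v = \sum_(i < n) a i *: w i].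

Definition subspace_of S I :=
  [/\ I `<=` S, I 0 & forall a u v, I u -> I v -> I (a *: u + v)].

Definition finite_dim S := exists b : seq V, S = lspan [set` b].

(* [dim (S / J)] is finite: the classes modulo [J] of finitely many elements
   of [S] span [S / J]. *)
Definition finite_codim S J :=
  exists2 b : seq V, [set` b] `<=` S &
    forall v, S v -> exists2 w, lspan [set` b] w & J (v - w).

Definition internal_direct_sum I F :=
  I = lspan (\bigcup_k F k) /\
  forall (ks : seq int) (x : int -> V), uniq ks -> (forall k, F k (x k)) ->
    \sum_(k <- ks) x k = 0 -> forall k, k \in ks -> x k = 0.

Variables (mul : V -> V -> V) (A : set V) (Ak : int -> set V).

Definition two_sided_ideal I :=
  subspace_of A I /\
  forall a x, A a -> I x -> I (mul a x) /\ I (mul x a).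

Definition graded_ideal I :=
  two_sided_ideal I /\ internal_direct_sum I (fun k => Ak k `&` I).

Definition graded_just_infinite :=
  ~ finite_dim A /\
  forall J, graded_ideal J -> J <> [set 0] -> finite_codim A J.

Definition graded_simple :=
  forall J, graded_ideal J -> J = [set 0] \/ J = A.

End GradedAlgebra.

Definition homeo_onto_image (X Y : topologicalType) (U : set X) (f : X -> Y) :=
  {within U, continuous f} /\
  exists2 g : Y -> X, {in U, cancel f g} & {within f @` U, continuous g}.

(** The partial map sigma is given by its domain [D] and a total function whose
    values outside [D] are never used. *)
Section DeaconuRenault.
Variables (X : topologicalType) (D : set X) (sigma : X -> X).

Definition local_homeomorphism :=
  forall x, D x -> exists U : set X,
    [/\ open U, U x, U `<=` D, open (sigma @` U) & homeo_onto_image U sigma].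

Record deaconu_renault : Prop := DeaconuRenault {
  dr_hausdorff : hausdorff_space X;
  dr_locally_compact : locally_compact [set: X];
  dr_open_dom : open D;
  dr_local_homeo : local_homeomorphism }.

Fixpoint dom_iter (n : nat) : set X :=
  if n is n'.+1 then [set x | dom_iter n' x /\ D (iter n' sigma x)]
  else [set: X].

Definition dr_arrows : set (X * int * X) :=
  [set g | exists m n : nat,
    [/\ g.1.2 = m%:Z - n%:Z, dom_iter m g.1.1, dom_iter n g.2 &
        iter m sigma g.1.1 = iter n sigma g.2]].

Definition dr_groupoid : Type := set_type dr_arrows.

HB.instance Definition _ := Choice.on dr_groupoid.

Implicit Types (f g h : dr_groupoid) (U V : set X).

Definition dr_range g : X := (val g).1.1.
Definition dr_degree g : int := (val g).1.2.
Definition dr_source g : X := (val g).2.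

Definition dr_cylinder U (m n : nat) V : set dr_groupoid :=
  [set g | [/\ U (dr_range g), V (dr_source g), dr_degree g = m%:Z - n%:Z &
    iter m sigma (dr_range g) = iter n sigma (dr_source g)]].

Definition dr_subbase : set (set dr_groupoid) :=
  [set W | exists U m n V, W = dr_cylinder U m n V /\
    [/\ open U, U `<=` dom_iter m & homeo_onto_image U (iter m sigma)] /\
    [/\ open V, V `<=` dom_iter n & homeo_onto_image V (iter n sigma)]].

HB.instance Definition _ :=
  isSubBaseTopological.Build dr_groupoid dr_subbase id.

(* [dr_comp f g h]: the pair (f, g) is composable, with product h. *)
Definition dr_comp f g h :=
  dr_source f = dr_range g /\
  val h = (dr_range f, dr_degree f + dr_degree g, dr_source g).

Definition dr_orbit (u : X) : set X :=
  [set dr_range g | g in [set g | dr_source g = u]].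

Definition dr_minimal := forall u : X, dense (dr_orbit u).

Lemma dom_iterD m n x :
  dom_iter (m + n) x <-> dom_iter n x /\ dom_iter m (iter n sigma x).
Proof.
elim: m => [|m IH] /=; first by split=> [|[]].
by rewrite iterD; split=> [[/IH[? ?] ?]|[? [? ?]]]; do ?split=> //; apply/IH.
Qed.

Lemma dr_arrows_unit x : dr_arrows (x, 0, x).
Proof. by exists 0%N, 0%N; split. Qed.

Lemma dr_arrows_inv x k y : dr_arrows (x, k, y) -> dr_arrows (y, - k, x).
Proof.
by move=> [m [n [/= -> ? ? ?]]]; exists n, m; split=> //=; rewrite opprB.
Qed.

Lemma dr_arrows_mul x k y l z :
  dr_arrows (x, k, y) -> dr_arrows (y, l, z) -> dr_arrows (x, k + l, z).
Proof.
move=> [m [n [/= -> dx dy exy]]] [p [q [/= -> dy' dz eyz]]].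
have [le|/ltnW le] := leqP n p.
  exists (p - n + m)%N, q; split=> //=.
  - by lia.
  - apply/dom_iterD; split=> //; rewrite exy.
    by move: dy'; rewrite -{1}(subnK le) => /dom_iterD[].
  - by rewrite iterD exy -iterD subnK.
exists m, (n - p + q)%N; split=> //=.
- by lia.
- apply/dom_iterD; split=> //; rewrite -eyz.
  by move: dy; rewrite -{1}(subnK le) => /dom_iterD[].
- by rewrite iterD -eyz -iterD subnK.
Qed.

Lemma dr_compP f g : dr_source f = dr_range g -> exists! h, dr_comp f g h.
Proof.
move=> fg.
have P : dr_arrows (dr_range f, dr_degree f + dr_degree g, dr_source g).
  apply: (@dr_arrows_mul _ _ (dr_source f)).
    have := set_valP f; rewrite /dr_range /dr_degree /dr_source.
    by case: (val f) => -[].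
  rewrite fg; have := set_valP g; rewrite /dr_range /dr_degree /dr_source.
  by case: (val g) => -[].
exists (exist (fun x => x \in dr_arrows) _ (mem_set P)); split=> // h [_ hE].
by apply: val_inj; rewrite hE.
Qed.

Variable K : fieldType.

Definition compact_open_bisection (B : set dr_groupoid) :=
  [/\ compact B, open B, set_inj B dr_range & set_inj B dr_source].

Definition steinberg : set (dr_groupoid -> K^o) :=
  lspan [set \1_B | B in compact_open_bisection].

Definition steinberg_degree (k : int) : set (dr_groupoid -> K^o) :=
  lspan [set \1_B | B in
    [set B | compact_open_bisection B /\ B `<=` dr_degree @^-1` [set k]]].

(* For fixed h and phi, psi in the Steinberg algebra the sum has finitely many
   nonzero terms; [convolution_indic] is the formula 1_U * 1_V = 1_(UV). *)
Definition convolution (phi psi : dr_groupoid -> K^o) : dr_groupoid -> K^o :=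
  fun h => \sum_(p \in [set p | dr_comp p.1 p.2 h]) phi p.1 * psi p.2.

Definition bisection_mul (A B : set dr_groupoid) : set dr_groupoid :=
  [set h | exists f g, [/\ A f, B g & dr_comp f g h]].

Lemma convolution_indic (A B : set dr_groupoid) :
  compact_open_bisection A -> compact_open_bisection B ->
  convolution \1_A \1_B = \1_(bisection_mul A B).
Proof.
move=> [_ _ injA _] [_ _ _ injB]; apply/funext => h; rewrite /convolution.
have [hAB|hAB] := pselect (bisection_mul A B h); last first.
  rewrite indicE memNset// fsbig1// => -[f g] /= fgh; rewrite !indicE.
  have [fA|fA] := pselect (A f); last by rewrite (memNset fA) mul0r.
  have [gB|gB] := pselect (B g); last by rewrite (memNset gB) mulr0.
  by case: hAB; exists f, g.
rewrite [in RHS]indicE mem_set//; case: hAB => f [g [fA gB fgh]].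
rewrite -(fsbig_widen [set (f, g)]).
- by rewrite fsbig_set1/= !indicE !mem_set// mulr1.
- by move=> _ ->.
- move=> [f' g'] /= [fgh' ne]; rewrite !indicE.
  have [fA'|fA'] := pselect (A f'); last by rewrite (memNset fA') mul0r.
  have [gB'|gB'] := pselect (B g'); last by rewrite (memNset gB') mulr0.
  case: ne; case: fgh fgh' => _ hE [_ hE'].
  move: hE; rewrite hE' => -[rE _ sE].
  by rewrite (injA f' f) ?inE// (injB g' g) ?inE.
Qed.

End DeaconuRenault.

Arguments steinberg {X} D sigma K _.
Arguments steinberg_degree {X} D sigma K k _.
Arguments convolution {X} D sigma K phi psi _.

(* Main.v *)
Require Import Defs.
From HB Require Import structures.
From mathcomp Require Import all_boot all_order all_algebra finmap.
From mathcomp Require Import all_classical topology numfun.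
From mathcomp Require Import zify.

Set Implicit Arguments.
Unset Strict Implicit.
Unset Printing Implicit Defensive.
Import Order.TTheory GRing.Theory Num.Theory.
Local Open Scope classical_set_scope.
Local Open Scope ring_scope.

(** Write G for the groupoid G(X, sigma) and A for its Steinberg algebra. The
    feature of G behind the theorem is that an arrow of degree k is determined
    by its range and its source, so that the degree-zero part of G is
    principal: graded ideals of A then see nothing but the open invariant
    subsets of X.

    Minimal implies graded simple. A nonzero graded ideal J contains a
    homogeneous f with f(g) <> 0 for some arrow g. Near g, f is a multiple of
    the indicator of a bisection, among the arrows whose range and source are
    close to those of g ([homogeneous_locally_indic]). Multiplying f on both
    sides by indicators of small compact open sets of units therefore puts 1_B
    in J for a compact open bisection B containing g
    ([ideal_homogeneous_indic]). From 1_(B^-1) * 1_B = 1_(s(B)) the set s(B)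
    belongs to the compact open sets of units whose indicator lies in J.
    By density of orbits it is carried along arrows to a neighbourhood of any
    unit ([ideal_units_nbhs]), and by compactness the range of every compact
    open bisection C is covered by one such set E, so that
    1_C = 1_E * 1_C is in J ([minimal_graded_ideal]). Since a nonzero graded
    ideal is then A itself, A is also graded just infinite.

    Graded simple implies minimal. For an invariant set Y the elements of A
    that vanish on the arrows with range in Y form a graded ideal
    ([vanishing_graded_ideal]). If the orbit Y of u is not dense, this ideal is
    neither 0 nor A.

    Graded just infinite implies minimal. If the orbit Y of u is not dense, the
    same ideal has finite codimension, which leaves room for only finitely many
    arrows with range in Y ([finite_codim_finite_arrows]). The arrows
    (u, n, sigma^n u) being pairwise distinct, u must leave the domain of sigma:
    some v = sigma^m u is not in D, hence is isolated. Isolation spreads along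
    arrows, so all points of Y and all arrows over Y are isolated. The ideal
    attached to the complement of Y is then nonzero, as it contains the point
    masses on the arrows over Y; it has finite codimension by hypothesis, and
    finite dimension because these masses span it. So A is finite-dimensional,
    a contradiction. *)

(** * Compact open sets in totally disconnected spaces *)

Section Compactness.
Variable T : topologicalType.
Implicit Types (K U V : set T) (x : T) (F : set (set T)).

(** Passage from local to global: covering K by neighbourhoods in [F], finitely
    many suffice, and their union is again in [F]. Used with [F] the sets that
    have some property with respect to a fixed point, arrow or ideal. *)
Lemma compact_sub_directed K F : compact K -> F set0 ->
  (forall U V, F U -> F V -> F (U `|` V)) ->
  (forall x, K x -> exists2 U, F U & nbhs x U) ->
  exists2 U, F U & K `<=` U.
Proof.
move=> /compact_near_coveringP Kc F0 FU Kcov.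
(* the filter of upper sections of the directed family [F] *)
pose G : set_system (set T) :=
  [set S | exists2 E0, F E0 & forall E, F E -> E0 `<=` E -> S E].
have GF : Filter G.
  split; first by exists set0.
  - move=> S1 S2 [E1 FE1 S1E] [E2 FE2 S2E]; exists (E1 `|` E2); first exact: FU.
    move=> E FE; rewrite subUset => -[? ?].
    by split; [exact: S1E|exact: S2E].
  - by move=> S1 S2 S12 [E FE SE]; exists E => // E1 FE1 ?; exact/S12/SE.
have [|E FE HE] := Kc _ G (fun E x => E x) GF.
  move=> x /Kcov[U HU nU]; exists (U, [set E | U `<=` E]) => /=.
    by split=> //; exists U.
  by move=> [y E] /= [Uy UE]; exact: UE.
by exists E => //; exact: HE.
Qed.

Lemma hausdorff_sep x y : hausdorff_space T -> x <> y ->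
  exists U V, [/\ open U, open V, U x, V y & U `&` V = set0].
Proof.
rewrite open_hausdorff => H /eqP/H[[U V]] /= [xU yV] [oU oV /eqP UV].
by exists U, V; split=> //; exact: set_mem.
Qed.

Lemma compact_sep K L : hausdorff_space T -> compact K -> compact L ->
  K `&` L = set0 ->
  exists U V, [/\ open U, open V, K `<=` U, L `<=` V & U `&` V = set0].
Proof.
move=> HT Kc Lc KL.
have [|||U [oU [V [oV LV UV]]] KU] := @compact_sub_directed K
  [set U | open U /\ exists V, [/\ open V, L `<=` V & U `&` V = set0]] Kc.
- by split; [exact: open0|exists setT; split=> //; [exact: openT|rewrite set0I]].
- move=> U1 U2 [oU1 [V1 [oV1 LV1 UV1]]] [oU2 [V2 [oV2 LV2 UV2]]].
  split; [exact: openU|exists (V1 `&` V2); split; first exact: openI].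
    by move=> x Lx; split; [exact: LV1|exact: LV2].
  by rewrite setIUl setIA UV1 set0I set0U (setIC V1) setIA UV2 set0I.
- move=> x Kx.
  have [|||V [oV [U [oU Ux UV]]] LV] := @compact_sub_directed L
    [set V | open V /\ exists U, [/\ open U, U x & U `&` V = set0]] Lc.
  + by split; [exact: open0|exists setT; split=> //; [exact: openT|rewrite setI0]].
  + move=> V1 V2 [oV1 [U1 [oU1 LU1 UV1]]] [oV2 [U2 [oU2 LU2 UV2]]].
    split; [exact: openU|exists (U1 `&` U2); split=> //; first exact: openI].
    by rewrite setIUr setIAC UV1 set0I set0U -setIA UV2 setI0.
  + move=> y Ly; have /(hausdorff_sep HT)[U [V [oU oV Ux Vy UV]]] : x <> y.
      move=> xy; move: KL; rewrite -subset0 => /(_ x); apply; split=> //.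
      by rewrite xy.
    exists V; last exact: open_nbhs_nbhs.
    by split=> //; exists U.
  + exists U; last exact: open_nbhs_nbhs.
    by split=> //; exists V.
- by exists U, V; split.
Qed.

Section CompactOpenBase.
Hypotheses (HT : hausdorff_space T) (lcT : locally_compact [set: T]).
Hypothesis tdT : totally_disconnected [set: T].

(** In a compact Hausdorff neighbourhood [K] of [x], the intersection [Q] of the
    relatively clopen sets containing [x] is connected, for a partition of [Q]
    into two closed sets extends to disjoint open sets and then to one of these
    clopen sets. So [Q] is reduced to [x], and one of the clopen sets fits in
    the interior of [K `&` U], where relatively open means open. *)
Lemma compact_open_nbhs x U : nbhs x U ->
  exists C, [/\ compact C, open C, C x & C `<=` U].
Proof.
move=> nU; have [K nK [Kc Kcl]] := lcT (x := x) I; rewrite withinET in nK.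
pose O := (K `&` U)°.
have Ox : O x by apply: nbhs_singleton; apply: nbhs_interior; exact: filterI.
have oO : open O by exact: open_interior.
have OKU : O `<=` K `&` U by exact: interior_subset.
(* the pieces of the partitions of K into two closed sets that contain x *)
pose Cx := [set C | [/\ C x, C `<=` K, closed C & closed (K `\` C)]].
pose Q := \bigcap_(C in Cx) C.
have CxK : Cx K.
  by split=> //; [exact: nbhs_singleton|rewrite setDv; exact: closed0].
have Qcl : closed Q by apply: closed_bigI => C [].
have QK : Q `<=` K by move=> y; exact.
have Qx : Q x by move=> C [].
have shrink (L : set T) : closed L -> L `<=` K -> Q `&` L = set0 ->
    exists2 C, Cx C & C `&` L = set0.
  move=> Lcl LK QL.
  have [|||E [C CxC EC] LE] := @compact_sub_directed L
    [set E | exists2 C, Cx C & C `&` E = set0] (subclosed_compact Lcl Kc LK).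
  - by exists K => //; rewrite setI0.
  - move=> E1 E2 [C1 [C1x C1K C1c C1k] CE1] [C2 [C2x C2K C2c C2k] CE2].
    exists (C1 `&` C2).
      split=> //; [by move=> y [/C1K]|exact: closedI|].
      by rewrite setDIr; exact: closedU.
    by rewrite setIUr setIAC CE1 set0I set0U -setIA CE2 setI0.
  - move=> y Ly; have : ~ Q y.
      by move=> Qy; move: QL; rewrite -subset0 => /(_ y); apply.
    move=> /existsNP[C /not_implyP[CxC nCy]]; exists (~` C).
      by exists C => //; rewrite setICr.
    by apply: open_nbhs_nbhs; split=> //; rewrite openC; case: CxC.
  - by exists C => //; rewrite -subset0 -EC; exact: setIS.
have Q1 : Q = [set x].
  apply/seteqP; split; last by move=> _ ->.
  rewrite -(tdT (x := x) I); apply: connected_component_max => //.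
  move=> B [b Bb] [C1 oC1 BC1] [C2 cC2 BC2].
  have Bcl : closed B by rewrite BC2; exact: closedI.
  have BQ : B `<=` Q by rewrite BC1; exact: subIsetl.
  pose E := Q `\` B.
  have Ecl : closed E.
    rewrite (_ : E = Q `&` ~` C1); first by apply: closedI => //; rewrite closedC.
    rewrite /E BC1; apply/seteqP; split=> y [Qy].
      by move=> n; split=> // ?; exact: n.
    by move=> n; split=> // -[].
  have EK : E `<=` K by move=> y [/QK].
  have BK : B `<=` K by move=> y /BQ/QK.
  have BE : B `&` E = set0 by rewrite /E setDE setIC -setIA setICl setI0.
  have [U1 [U2 [oU1 oU2 BU1 EU2 U12]]] := compact_sep HT
    (subclosed_compact Bcl Kc BK) (subclosed_compact Ecl Kc EK) BE.
  have QU y : Q y -> U1 y \/ U2 y.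
    by move=> Qy; have [/BU1|nB] := pselect (B y); [left|right; apply: EU2].
  have [||| C [Cx' CK Cc CKc] CL] := shrink (K `\` (U1 `|` U2)).
  - by rewrite setDE; apply: closedI => //; rewrite closedC; exact: openU.
  - exact: subDsetl.
  - by rewrite -subset0 => y [/QU + [_]].
  have CU y : C y -> U1 y \/ U2 y.
    move=> Cy; apply: contrapT => nUy; move: CL; rewrite -subset0 => /(_ y).
    by apply; split=> //; split=> //; exact: CK.
  have U12F y : U1 y -> U2 y -> False.
    by move=> ? ?; move: U12; rewrite -subset0 => /(_ y); apply.
  (* the side containing x of a splitting of C is again one of the pieces *)
  have half (V W : set T) : open V -> open W -> V `&` W = set0 ->
      (forall y, C y -> V y \/ W y) -> V x -> Q `<=` V.
    move=> oV oW VW CVW Vx.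
    have VWF y : V y -> W y -> False.
      by move=> ? ?; move: VW; rewrite -subset0 => /(_ y); apply.
    have CV : C `&` V = C `&` ~` W.
      apply/seteqP; split=> y [Cy ?]; split=> //; first by move=> /VWF; exact.
      by have [] := CVW _ Cy.
    suff : Cx (C `&` V) by move=> + y Qy => /Qy[].
    split=> //; first by move=> y [/CK].
      by rewrite CV; apply: closedI => //; rewrite closedC.
    rewrite (_ : _ `\` _ = (K `\` C) `|` (C `&` ~` V)).
      by apply: closedU => //; apply: closedI => //; rewrite closedC.
    apply/seteqP; split=> y.
      move=> [Ky n]; have [Cy|] := pselect (C y); last by left.
      by right; split=> // Vy; exact: n.
    by move=> [[Ky nC]|[/[dup] /CK ? Cy nV]]; split=> // -[].
  apply/seteqP; split=> // y Qy; apply: contrapT => nBy.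
  have [U1x|U2x] := QU _ Qx.
    by apply: (U12F y); [exact: (half U1 U2)|exact: EU2].
  have QU2 : Q `<=` U2.
    apply: (half U2 U1) => //; first by rewrite setIC.
    by move=> z /CU[]; [right|left].
  exact: (U12F b (BU1 _ Bb) (QU2 _ (BQ _ Bb))).
have [|||C [Cx' CK Cc CKc] CL] := shrink (K `\` O).
- by rewrite setDE; apply: closedI => //; rewrite closedC.
- exact: subDsetl.
- by rewrite Q1 -subset0 => y [-> []].
have CO : C `<=` O.
  move=> y Cy; apply: contrapT => nO; move: CL; rewrite -subset0 => /(_ y).
  by apply; split=> //; split=> //; exact: CK.
exists C; split=> //.
- exact: subclosed_compact Kc CK.
- rewrite (_ : C = O `&` ~` (K `\` C)); first by apply: openI => //; rewrite openC.
  apply/seteqP; split=> y; first by move=> Cy; split; [exact: CO|move=> []].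
  by move=> [Oy n]; apply: contrapT => nC; apply: n; split=> //; case: (OKU _ Oy).
- by move=> y /CO/OKU[].
Qed.

End CompactOpenBase.
End Compactness.

(** * Iterates of a partial local homeomorphism *)

Section LocalHomeomorphism.
Variables (S T : topologicalType).
Implicit Types (f : S -> T) (U N : set S) (x : S).

Lemma homeo_onto_image_continuous_open f U x :
  open U -> open (f @` U) -> homeo_onto_image U f -> U x ->
  {for x, continuous f} /\ forall N, nbhs x N -> nbhs (f x) (f @` N).
Proof.
move=> oU ofU [fc [g gK gc]] Ux; split.
  by move: fc; rewrite continuous_open_subspace//; apply; rewrite inE.
move=> N nN; have fUx : (f @` U) (f x) by exists x.
have {}gc : {for f x, continuous g}.
  by move: gc; rewrite continuous_open_subspace//; apply; rewrite inE.
have : nbhs (f x) (f @` U `&` g @^-1` N).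
  apply: filterI; first exact: open_nbhs_nbhs.
  by apply: gc; rewrite gK// inE.
by apply: filterS => _ [[z Uz <-]]; rewrite /preimage /= gK ?inE// => Nz; exists z.
Qed.

(** The converse of the previous lemma. The point [x] only serves as a value for
    the inverse off the image of [U]. *)
Lemma open_injective_homeo_onto_image f U x : open U -> U x ->
  {in U &, injective f} ->
  (forall z, U z -> {for z, continuous f}) ->
  (forall z N, U z -> nbhs z N -> nbhs (f z) (f @` N)) ->
  homeo_onto_image U f.
Proof.
move=> oU Ux finj fc fo; split.
  by rewrite continuous_open_subspace// => z; rewrite inE; exact: fc.
pose g y := xget x [set z | U z /\ f z = y].
have gK : {in U, cancel f g}.
  move=> z /[!inE] Uz; rewrite /g; case: xgetP => [z' _ [Uz' zz']|].
    by apply: finj; rewrite ?inE.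
  by move/(_ z)/not_andP => [].
exists g => //; apply/subspace_continuousP => _ [z Uz <-] N.
have -> : nbhs (g (f z)) N = nbhs z N by rewrite gK ?inE.
move=> nN; rewrite /= nbhs_simpl /=.
have : nbhs (f z) (f @` (U `&` N)).
  by apply: fo => //; apply: filterI => //; exact: open_nbhs_nbhs.
rewrite /within /= nbhs_simpl /=.
by apply: filterS => _ [w [Uw Nw] <-] _ /=; rewrite /from_subspace gK ?inE.
Qed.

End LocalHomeomorphism.

Section Iterates.
Variables (X : topologicalType) (D : set X) (sigma : X -> X).
Hypothesis HDR : deaconu_renault D sigma.

Lemma sigma_continuous_open x : D x ->
  {for x, continuous sigma} /\ forall N, nbhs x N -> nbhs (sigma x) (sigma @` N).
Proof.
move=> /(dr_local_homeo HDR)[U [oU Ux _ osU]].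
by move=> /homeo_onto_image_continuous_open; exact.
Qed.

Lemma iter_continuous n x : dom_iter D sigma n x ->
  {for x, continuous (iter n sigma)}.
Proof.
elim: n => [|n IH] /=; first by move=> _; exact: cvg_id.
move=> [/IH cn /sigma_continuous_open[cs _]].
exact: (continuous_comp cn cs).
Qed.

Lemma iter_open n x N : dom_iter D sigma n x -> nbhs x N ->
  nbhs (iter n sigma x) (iter n sigma @` N).
Proof.
elim: n => [|n IH] /=; first by move=> _; rewrite image_id.
move=> [dn /sigma_continuous_open[_ so]] nN.
have -> : (fun x0 => sigma (iter n sigma x0)) @` N = sigma @` (iter n sigma @` N).
  by rewrite image_comp.
exact/so/IH.
Qed.

Lemma dom_iter_nbhs n x : dom_iter D sigma n x -> nbhs x (dom_iter D sigma n).
Proof.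
elim: n => [|n IH] /=; first by move=> _; exact: filterT.
move=> [dn Dn]; have nD := open_nbhs_nbhs (conj (dr_open_dom HDR) Dn).
exact: filterI (IH dn) (iter_continuous dn nD).
Qed.

Lemma iter_locally_injective n x : dom_iter D sigma n x ->
  exists U, [/\ nbhs x U, U `<=` dom_iter D sigma n &
                {in U &, injective (iter n sigma)}].
Proof.
elim: n => [|n IH] /=; first by move=> _; exists setT; split=> //; exact: filterT.
move=> [dn Dn]; have [U [nU Ud Uinj]] := IH dn.
have [V [oV Vx VD _ [_ [g gK _]]]] := dr_local_homeo HDR Dn.
exists (U `&` iter n sigma @^-1` V); split.
- apply: filterI => //; apply: (iter_continuous dn).
  exact: open_nbhs_nbhs.
- by move=> y [/Ud ? /VD].
- move=> y z /[!inE] -[Uy Vy] [Uz Vz] /(congr1 g).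
  by rewrite !gK ?inE// => /Uinj; apply; rewrite inE.
Qed.

Lemma iter_homeo_nbhs n x N : dom_iter D sigma n x -> nbhs x N ->
  exists U, [/\ open U, U x, U `<=` N, U `<=` dom_iter D sigma n &
                homeo_onto_image U (iter n sigma)].
Proof.
move=> dn nN; have [V [nV Vd Vinj]] := iter_locally_injective dn.
have sub : (V `&` N)° `<=` V `&` N by exact: interior_subset.
have VNx : (V `&` N)° x.
  by apply: nbhs_singleton; apply: nbhs_interior; exact: filterI.
exists (V `&` N)°; split=> //; first exact: open_interior.
- by move=> z /sub[].
- by move=> z /sub[/Vd].
- apply: open_injective_homeo_onto_image VNx _ _ _; first exact: open_interior.
  + by move=> y z /[!inE] /sub[? _] /sub[? _]; apply: Vinj; rewrite inE.
  + by move=> z /sub[/Vd ? _]; exact: iter_continuous.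
  + by move=> z M /sub[/Vd ? _]; exact: iter_open.
Qed.

End Iterates.

(** * The topology of the groupoid *)

Section Groupoid.
Variables (X : topologicalType) (D : set X) (sigma : X -> X).
Local Notation G := (dr_groupoid D sigma).
Local Notation dom := (dom_iter D sigma).
Implicit Types (g h : G) (U V : set X) (m n : nat).

Lemma arrow_ext g h : dr_range g = dr_range h -> dr_degree g = dr_degree h ->
  dr_source g = dr_source h -> g = h.
Proof.
rewrite /dr_range /dr_degree /dr_source => r c s; apply: val_inj.
by case: (val g) (val h) r c s => -[? ?] ? [[? ?] ?] /= -> -> ->.
Qed.

Lemma arrow_exists x k y : dr_arrows D sigma (x, k, y) ->
  exists g : G, [/\ dr_range g = x, dr_degree g = k & dr_source g = y].
Proof.
by move=> P; exists (exist (fun z => z \in dr_arrows D sigma) _ (mem_set P)).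
Qed.

(** [lag g m n]: the pair (m, n) is one of those that witness that [g] is an
    arrow. All the witnesses are obtained from a minimal one by adding the same
    number to both components. *)
Definition lag g m n := [/\ dr_degree g = m%:Z - n%:Z,
  dom m (dr_range g), dom n (dr_source g) &
  iter m sigma (dr_range g) = iter n sigma (dr_source g)].

Lemma lag_exists g : exists m n, lag g m n.
Proof. exact: set_valP g. Qed.

(** Witnesses of two arrows can thus be adjusted to each other, as is needed to
    multiply the arrows. *)
Lemma lag_shift g m n j : lag g m n -> dom (n + j) (dr_source g) ->
  lag g (m + j) (n + j).
Proof.
move=> [gE dr ds e] dj; split=> //.
- by rewrite gE; lia.
- rewrite addnC; apply/dom_iterD; split=> //; rewrite e.
  by move: dj; rewrite addnC => /dom_iterD[].
- by rewrite addnC iterD e -iterD addnC.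
Qed.

Lemma lag_of x m n y : dom m x -> dom n y -> iter m sigma x = iter n sigma y ->
  exists g : G, [/\ lag g m n, dr_range g = x & dr_source g = y].
Proof.
move=> dx dy e; have [|g [rg cg sg]] := @arrow_exists x (m%:Z - n%:Z) y.
  by exists m, n.
by exists g; split=> //; split; rewrite ?rg ?sg.
Qed.

Lemma dr_arrow_inv g : dr_arrows D sigma (dr_source g, - dr_degree g, dr_range g).
Proof.
apply: dr_arrows_inv; have := set_valP g; rewrite /dr_source /dr_range /dr_degree.
by case: (val g) => -[].
Qed.

Definition inv_arrow g : G :=
  exist (fun z => z \in dr_arrows D sigma) _ (mem_set (dr_arrow_inv g)).

Lemma inv_arrowK : involutive inv_arrow.
Proof. by move=> g; apply: arrow_ext => //; exact: opprK. Qed.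

Definition unit_arrow x : G :=
  exist (fun z => z \in dr_arrows D sigma) _ (mem_set (dr_arrows_unit D sigma x)).

Definition chart n U :=
  [/\ open U, U `<=` dom n & homeo_onto_image U (iter n sigma)].

Lemma chart_open n U : chart n U -> open U.
Proof. by case. Qed.

Lemma chart_sub n U V : chart n U -> open V -> V `<=` U -> chart n V.
Proof.
move=> [oU Ud [Uc [f fK fc]]] oV VU; split=> //; first exact: subset_trans Ud.
split; first exact: continuous_subspaceW VU Uc.
exists f; first by move=> x /[!inE] /VU ?; apply: fK; rewrite inE.
apply: continuous_subspaceW fc; exact: image_subset.
Qed.

Lemma chart_inj n U : chart n U -> {in U &, injective (iter n sigma)}.
Proof. by move=> [_ _ [_ [f fK _]]] x y xU yU e; rewrite -[x]fK// e fK. Qed.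

Lemma open_cylinder U m n V : chart m U -> chart n V ->
  open (dr_cylinder U m n V : set G).
Proof.
move=> [? ? ?] [? ? ?]; set W := dr_cylinder _ _ _ _.
exists [set W]; last first.
  by rewrite predeqE => ?; split=> [[_ ->]|] //; exists W.
by move=> _ ->; apply: finI_from1 => /=; exists U, m, n, V.
Qed.

Hypothesis HDR : deaconu_renault D sigma.

Lemma chart_nbhs n x N : dom n x -> nbhs x N ->
  exists U, [/\ chart n U, U x & U `<=` N].
Proof.
by move=> dn /(iter_homeo_nbhs HDR dn)[U [oU Ux UN Ud hU]]; exists U.
Qed.

Definition cylinder_at g (W : set G) := exists U m n V,
  [/\ chart m U, chart n V, W = dr_cylinder U m n V & W g].

(** The subbase is in fact a base: of the two pairs (m, n) and (m + p, n + p)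
    the smaller one gives the stronger equation, so that it may be kept alone. *)
Lemma cylinder_atI g W1 W2 : cylinder_at g W1 -> cylinder_at g W2 ->
  exists2 W, cylinder_at g W & W `<=` W1 `&` W2.
Proof.
move=> [U [m [n [V [cU cV -> Wg]]]]] [U' [m' [n' [V' [cU' cV' -> Wg']]]]].
wlog le : U m n V cU cV Wg U' m' n' V' cU' cV' Wg' / (m <= m')%N.
  move=> H; have [/H|/ltnW/H] := leqP m m'; first exact.
  by rewrite setIC; apply.
case: Wg Wg' => [Ur Vs ck e] [Ur' Vs' ck' _].
have [p [mE nE]] : exists p, m' = (p + m)%N /\ n' = (p + n)%N.
  by exists (m' - m)%N; split; move: ck ck'; lia.
exists (dr_cylinder (U `&` U') m n (V `&` V')).
  exists (U `&` U'), m, n, (V `&` V'); split=> //.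
  - apply: (chart_sub cU); last exact: subIsetl.
    exact: openI (chart_open cU) (chart_open cU').
  - apply: (chart_sub cV); last exact: subIsetl.
    exact: openI (chart_open cV) (chart_open cV').
move=> h [[hU hU'] [hV hV'] kh eh]; split; split=> //; first by rewrite kh -ck.
by rewrite mE nE !iterD eh.
Qed.

Lemma cylinder_at_nbhs g W : cylinder_at g W -> nbhs g W.
Proof.
move=> [U [m [n [V [cU cV -> Wg]]]]]; apply: open_nbhs_nbhs; split=> //.
exact: open_cylinder.
Qed.

Lemma lag_cylinder_at g m n : lag g m n ->
  forall N M, nbhs (dr_range g) N -> nbhs (dr_source g) M ->
  exists U V, [/\ chart m U, chart n V, U `<=` N, V `<=` M &
    (dr_cylinder U m n V : set G) g].
Proof.
move=> [gE dr ds e] N M.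
move=> /(chart_nbhs dr)[U [cU Ur UN]] /(chart_nbhs ds)[V [cV Vs VM]].
by exists U, V.
Qed.

Lemma cylinder_base g N : nbhs g N -> exists2 W, cylinder_at g W & W `<=` N.
Proof.
rewrite nbhsE => -[_ [[B sB <-] [C BC Cg] sUBN]].
have FF : Filter (filter_from (cylinder_at g) id).
  apply: filter_from_filter; last exact: cylinder_atI.
  have [m [n l]] := lag_exists g.
  have [||U [V [cU cV _ _ Zg]]] := lag_cylinder_at l (N := setT) (M := setT).
  - exact: filterT.
  - exact: filterT.
  by exists (dr_cylinder U m n V : set G); exists U, m, n, V.
suff : filter_from (cylinder_at g) id C.
  by move=> [W aW WC]; exists W => // h /WC Ch; apply: sUBN; exists C.
have [F sF FC] := sB _ BC; rewrite -FC; apply: filter_bigI => E EF.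
have /sF := EF; rewrite inE => -[U [m [n [V [EE [[? ? ?] [? ? ?]]]]]]].
exists E => //; exists U, m, n, V; split=> //.
by move: Cg; rewrite -FC => /(_ _ EF).
Qed.

(** Basic neighbourhoods exist for any prescribed witness of [g]. Passing to a
    smaller witness strengthens the equation that defines the cylinder; passing
    to a larger one costs nothing locally, because iterates of [sigma] are
    locally injective. *)
Lemma lag_base g m n N : lag g m n -> nbhs g N ->
  exists U V, [/\ chart m U, chart n V, (dr_cylinder U m n V : set G) g &
                  (dr_cylinder U m n V : set G) `<=` N].
Proof.
move=> l /cylinder_base[_ [U0 [m0 [n0 [V0 [cU0 cV0 -> [Ur Vs k e]]]]]] WN].
have [gE dr ds e'] := l.
have nU0 : nbhs (dr_range g) U0.
  by apply: open_nbhs_nbhs; split=> //; exact: chart_open cU0.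
have nV0 : nbhs (dr_source g) V0.
  by apply: open_nbhs_nbhs; split=> //; exact: chart_open cV0.
have [le|/ltnW le] := leqP m m0.
  have [U [V [cU cV UU0 VV0 Zg]]] := lag_cylinder_at l nU0 nV0.
  exists U, V; split=> // h [/UU0 Uh /VV0 Vh kh eh]; apply: WN; split=> //.
    by rewrite kh -gE k.
  have [p [-> ->]] : exists p, m0 = (p + m)%N /\ n0 = (p + n)%N.
    by exists (m0 - m)%N; split; move: k gE; lia.
  by rewrite !iterD eh.
have [p [mE nE]] : exists p, m = (p + m0)%N /\ n = (p + n0)%N.
  by exists (m - m0)%N; split; move: k gE; lia.
have dr0 := dr; have ds0 := ds; move: dr0 ds0.
rewrite {1}mE {1}nE => /dom_iterD[dr0 dp] /dom_iterD[ds0 _].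
have [I [nI _ injI]] := iter_locally_injective HDR dp.
have [||U [V [cU cV UU0 VV0 Zg]]] := lag_cylinder_at l
    (N := U0 `&` iter m0 sigma @^-1` I) (M := V0 `&` iter n0 sigma @^-1` I).
- by apply: filterI => //; exact: (iter_continuous HDR dr0).
- by apply: filterI => //; apply: (iter_continuous HDR ds0); rewrite -e.
exists U, V; split=> // h [/UU0[Uh Ih] /VV0[Vh Jh] kh eh]; apply: WN; split=> //.
  by rewrite kh -gE k.
by apply: injI; rewrite ?inE// -!iterD -mE -nE.
Qed.

Lemma lag_near g m n : lag g m n -> \forall h \near g, lag h m n.
Proof.
move=> l; have [U [V [cU cV Zg _]]] := lag_base l filterT.
have : nbhs g (dr_cylinder U m n V : set G).
  by apply: cylinder_at_nbhs; exists U, m, n, V.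
by apply: filterS => h [Ur Vs kh eh]; split=> //; [case: cU|case: cV] => _ + _; apply.
Qed.

Lemma degree_near g : \forall h \near g, dr_degree h = dr_degree g.
Proof.
have [m [n l]] := lag_exists g; have := lag_near l.
by apply: filterS => h [-> _ _ _]; case: l.
Qed.

Lemma range_source_nbhs g N M : nbhs (dr_range g) N -> nbhs (dr_source g) M ->
  \forall h \near g, N (dr_range h) /\ M (dr_source h).
Proof.
move=> nN nM; have [m [n l]] := lag_exists g.
have [U [V [cU cV UN VM Zg]]] := lag_cylinder_at l nN nM.
have : nbhs g (dr_cylinder U m n V : set G).
  by apply: cylinder_at_nbhs; exists U, m, n, V.
by apply: filterS => h [/UN ? /VM].
Qed.

Lemma range_continuous : continuous (@dr_range X D sigma).
Proof.
by move=> g N nN; apply: filterS (range_source_nbhs nN filterT) => h [].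
Qed.

Lemma source_continuous : continuous (@dr_source X D sigma).
Proof.
by move=> g N nN; apply: filterS (range_source_nbhs filterT nN) => h [].
Qed.

Lemma inv_arrow_continuous : continuous inv_arrow.
Proof.
move=> g N /cylinder_base[_ [U [m [n [V [cU cV -> [Ur Vs k e]]]]]] WN].
have : nbhs g (dr_cylinder V n m U : set G).
  apply: cylinder_at_nbhs; exists V, n, m, U; split=> //; split=> //.
  have := k; rewrite {1}/dr_degree /= -/(dr_degree g) => /(congr1 -%R).
  by rewrite opprK opprB.
apply: filterS => h [Vh Uh kh eh]; apply: WN; split=> //.
by rewrite /dr_degree /= -/(dr_degree h) kh opprB.
Qed.

(** The range map is a local homeomorphism; openness is where the openness of
    the iterates of [sigma] enters: near the range of [g], a point [x] has
    sigma^m x in the open set sigma^n(V), hence is the range of an arrow. *)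
Lemma range_open g N : nbhs g N -> nbhs (dr_range g) (@dr_range X D sigma @` N).
Proof.
move=> /cylinder_base[_ [U [m [n [V [cU cV -> [Ur Vs k e]]]]]] WN].
have [oU Ud _] := cU; have [oV Vd _] := cV.
have nV : nbhs (iter m sigma (dr_range g)) (iter n sigma @` V).
  by rewrite e; apply: (iter_open HDR); [exact: Vd|exact: open_nbhs_nbhs].
have := iter_continuous HDR (Ud _ Ur) nV.
move/(filterI (open_nbhs_nbhs (conj oU Ur))).
apply: filterS => x [Ux [y Vy]] /esym/lag_of[||h [[kh _ _ eh] rh sh]].
- exact: Ud.
- exact: Vd.
by exists h => //; apply: WN; split; rewrite ?rh ?sh// -rh -sh.
Qed.

Lemma source_open g N : nbhs g N -> nbhs (dr_source g) (@dr_source X D sigma @` N).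
Proof.
move=> nN; have : nbhs (inv_arrow g) (inv_arrow @^-1` N).
  by apply: inv_arrow_continuous; rewrite inv_arrowK.
by move=> /range_open; apply: filterS => _ [h Nh <-]; exists (inv_arrow h).
Qed.

End Groupoid.

(** * Compact open bisections *)

Section Bisections.
Variables (X : topologicalType) (D : set X) (sigma : X -> X).
Local Notation G := (dr_groupoid D sigma).
Local Notation dom := (dom_iter D sigma).
Local Notation range := (@dr_range X D sigma).
Local Notation source := (@dr_source X D sigma).
Implicit Types (g h : G) (A B N W : set G) (C : set X).

Hypothesis HDR : deaconu_renault D sigma.

(** On an open set where it is injective the open map [range] is a homeomorphism
    onto its image, so compactness can be lifted from X to the groupoid. *)
Lemma compact_range_preimage B C : open B -> set_inj B range ->
  compact C -> C `<=` range @` B -> compact (B `&` range @^-1` C).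
Proof.
move=> oB Binj /compact_near_coveringP Cc CB; apply/compact_near_coveringP.
move=> I F P FF cov.
have : \near F, C `<=` (fun y => forall h, B h -> range h = y -> P F h).
  apply: Cc => y Cy; have [g Bg gy] := CB _ Cy.
  have [|[N M] /= [nN FM] NM] := cov g; first by split=> //; rewrite /= gy.
  exists (range @` (N `&` B), M) => /=.
    split=> //; rewrite -gy; apply: (range_open HDR); apply: filterI => //.
    exact: open_nbhs_nbhs.
  move=> [_ i] /= [[h [Nh Bh] <-] Mi] h' Bh' /Binj h'h.
  by rewrite h'h ?inE//; apply: (NM (h, i)).
by apply: filterS => i H g [Bg Cg]; exact: H Cg _ _ _.
Qed.

Lemma degree_clopen (k : int) : clopen (@dr_degree X D sigma @^-1` [set k]).
Proof.
split.
  rewrite openE => g <-; apply: filterS (degree_near HDR g) => h; exact.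
rewrite -openC openE => g gk; apply: filterS (degree_near HDR g) => h hg /= hk.
by apply: gk; rewrite /= -hg.
Qed.

Lemma cob_clopenI B W : compact_open_bisection B -> clopen W ->
  compact_open_bisection (B `&` W).
Proof.
move=> [Bc Bo rB sB] [Wo Wc]; split.
- exact: compact_closedI.
- exact: openI.
- by move=> g h /[!inE] -[? _] [? _]; apply: rB; rewrite inE.
- by move=> g h /[!inE] -[? _] [? _]; apply: sB; rewrite inE.
Qed.

Lemma cob_range_compact B : compact_open_bisection B -> compact (range @` B).
Proof.
move=> [Bc _ _ _]; apply: continuous_compact => //.
exact/continuous_subspaceT/range_continuous.
Qed.

Lemma cob_source_open B : compact_open_bisection B -> open (source @` B).
Proof.
move=> [_ Bo _ _]; rewrite openE => _ [g Bg <-].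
by apply: (source_open HDR); exact: open_nbhs_nbhs.
Qed.

Lemma cob_inv B : compact_open_bisection B ->
  compact_open_bisection (@inv_arrow X D sigma @` B).
Proof.
move=> [Bc Bo rB sB].
have E : @inv_arrow X D sigma @` B = @inv_arrow X D sigma @^-1` B.
  apply/seteqP; split=> [_ [g Bg <-]|g Bg] /=; first by rewrite inv_arrowK.
  by exists (inv_arrow g) => //; rewrite inv_arrowK.
split.
- apply: continuous_compact => //.
  exact/continuous_subspaceT/inv_arrow_continuous.
- rewrite E; move/continuousP: (@inv_arrow_continuous X D sigma HDR); exact.
- move=> g h /[!inE] -[g' Bg' <-] [h' Bh' <-] e; congr inv_arrow.
  by apply: sB; rewrite ?inE.
- move=> g h /[!inE] -[g' Bg' <-] [h' Bh' <-] e; congr inv_arrow.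
  by apply: rB; rewrite ?inE.
Qed.

Lemma open_units : open (unit_arrow D sigma @` [set: X]).
Proof.
rewrite openE => _ [x _ <-].
have : lag (unit_arrow D sigma x) 0 0 by split.
move=> /(lag_near HDR); apply: filterS => g [k _ _ /= e].
by exists (dr_range g) => //; apply: arrow_ext.
Qed.

Lemma cob_units C : compact C -> open C ->
  compact_open_bisection (unit_arrow D sigma @` C).
Proof.
move=> Cc Co; have E : unit_arrow D sigma @` C =
    unit_arrow D sigma @` [set: X] `&` range @^-1` C.
  apply/seteqP; split=> [_ [x Cx <-]|_ [[x _ <-] Cx]]; last by exists x.
  by split=> //; exists x.
split.
- rewrite E; apply: compact_range_preimage => //; first exact: open_units.
    by move=> g h /[!inE] -[x _ <-] [y _ <-]; rewrite /dr_range /= => ->.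
  by move=> x _; exists (unit_arrow D sigma x) => //; exists x.
- rewrite E; apply: openI; first exact: open_units.
  by move/continuousP: (range_continuous HDR); exact.
- by move=> g h /[!inE] -[x _ <-] [y _ <-]; rewrite /dr_range /= => ->.
- by move=> g h /[!inE] -[x _ <-] [y _ <-]; rewrite /dr_source /= => ->.
Qed.

Lemma dr_compE g f h : dr_comp g f h -> [/\ source g = range f,
  range h = range g, dr_degree h = dr_degree g + dr_degree f & source h = source f].
Proof.
move=> [gf hE]; split=> //; first by rewrite [LHS]/dr_range hE.
  by rewrite [LHS]/dr_degree hE.
by rewrite [LHS]/dr_source hE.
Qed.

Lemma comp_lag g f : source g = range f ->
  exists m l n, lag g m l /\ lag f l n.
Proof.
move=> e; have [m [p lg]] := lag_exists g; have [q [n lf]] := lag_exists f.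
have [pq|/ltnW qp] := leqP p q.
  exists (m + (q - p))%N, q, n; split=> //; rewrite -{2}(subnKC pq).
  by apply: lag_shift => //; rewrite subnKC// e; case: lf.
exists m, p, (n + (p - q))%N; split=> //; rewrite -{1}(subnKC qp).
have [fE drf dsf ef] := lf; have [_ _ dsg _] := lg.
rewrite /lag.
have dp : dom (q + (p - q)) (range f) by rewrite subnKC// -e.
split=> //; first by rewrite fE; lia.
  rewrite addnC; apply/dom_iterD; split=> //; rewrite -ef.
  by move: dp; rewrite addnC => /dom_iterD[].
by rewrite addnC iterD ef -iterD addnC.
Qed.

(** For composable g in A and f in B with witnesses (m, l) and (l, n), the pair
    (m, n) is a witness of the product h. If h' is close to h then sigma^m of its
    range lies in sigma^l(V `&` V'), which provides the middle point [y] of a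
    factorization of h'. *)
Lemma open_bisection_mul A B : open A -> open B -> open (bisection_mul A B).
Proof.
move=> oA oB; rewrite openE => h [g [f [Ag Bf /dr_compE[gf rh kh sh]]]].
have [m [l [n [lg lf]]]] := comp_lag gf.
have nA : nbhs g A by exact: open_nbhs_nbhs.
have nB : nbhs f B by exact: open_nbhs_nbhs.
have [U [V [cU cV [Ur Vs _ eg] ZA]]] := lag_base HDR lg nA.
have [V' [W [cV' cW [Vr Ws _ ef] ZB]]] := lag_base HDR lf nB.
have [gE drg dsg _] := lg; have [fE drf dsf _] := lf.
have lh : lag h m n.
  by split; rewrite ?rh ?sh ?kh ?gE ?fE ?eg ?gf//; lia.
have nV : nbhs (iter m sigma (range h)) (iter l sigma @` (V `&` V')).
  rewrite rh eg; apply: (iter_open HDR) => //; apply: filterI.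
    by apply: open_nbhs_nbhs; split=> //; exact: chart_open cV.
  by rewrite gf; apply: open_nbhs_nbhs; split=> //; exact: chart_open cV'.
have [||U1 [W1 [cU1 cW1 U1s W1s Zh]]] := lag_cylinder_at HDR lh
    (N := U `&` iter m sigma @^-1` (iter l sigma @` (V `&` V'))) (M := W).
- apply: filterI.
    by rewrite rh; apply: open_nbhs_nbhs; split=> //; exact: chart_open cU.
  by apply: (iter_continuous HDR); rewrite ?rh// -rh.
- by rewrite sh; apply: open_nbhs_nbhs; split=> //; exact: chart_open cW.
have : nbhs h (dr_cylinder U1 m n W1 : set G).
  by apply: cylinder_at_nbhs; exists U1, m, n, W1.
apply: filterS => h' [/U1s[Uh' [y [Vy Vy'] ye]] /W1s Wh' kh' eh'].
have [oU Ud _] := cU; have [oV Vd _] := cV; have [oW Wd _] := cW.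
have [g' [[kg' _ _ eg'] rg' sg']] := lag_of (Ud _ Uh') (Vd _ Vy) (esym ye).
have [f' [[kf' _ _ ef'] rf' sf']] := lag_of (Vd _ Vy) (Wd _ Wh') (etrans ye eh').
exists g', f'; split.
- by apply: ZA; split; rewrite ?rg' ?sg'.
- by apply: ZB; split; rewrite ?rf' ?sf' ?ye.
- split; first by rewrite sg' rf'.
  rewrite rg' kg' kf' sf' (_ : _ + _ = dr_degree h'); last by rewrite kh'; lia.
  by rewrite /dr_range /dr_degree /dr_source; case: (val h') => -[].
Qed.

Hypothesis Xtd : totally_disconnected [set: X].

(** Cylinders over charts are open bisections; a compact open piece of their
    range cuts out compact ones. *)
Lemma cob_base g N : nbhs g N ->
  exists B, [/\ compact_open_bisection B, B g & B `<=` N].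
Proof.
move=> nN; have [m [n l]] := lag_exists g.
have [U [V [cU cV Zg ZN]]] := lag_base HDR l nN.
set Z := dr_cylinder _ _ _ _ in Zg ZN.
have oZ : open Z by exact: open_cylinder.
have rZ : set_inj Z range.
  move=> h h' /[!inE] -[Uh Vh kh eh] [Uh' Vh' kh' eh'] r.
  apply: arrow_ext => //; first by rewrite kh kh'.
  by apply: (chart_inj cV); rewrite ?inE// -eh -eh' r.
have sZ : set_inj Z source.
  move=> h h' /[!inE] -[Uh Vh kh eh] [Uh' Vh' kh' eh'] s.
  apply: arrow_ext => //; last by rewrite kh kh'.
  by apply: (chart_inj cU); rewrite ?inE// eh eh' s.
have [C [Cc Co Cg CZ]] := compact_open_nbhs (dr_hausdorff HDR)
  (dr_locally_compact HDR) Xtd (range_open HDR (open_nbhs_nbhs (conj oZ Zg))).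
exists (Z `&` range @^-1` C); split=> //; last by move=> h [/ZN].
split.
- exact: compact_range_preimage.
- by apply: openI => //; move/continuousP: (range_continuous HDR); exact.
- by move=> h h' /[!inE] -[? _] [? _]; apply: rZ; rewrite inE.
- by move=> h h' /[!inE] -[? _] [? _]; apply: sZ; rewrite inE.
Qed.

(** The product of two bisections is a bisection whose range is the image of
    the closed part of A with source in the range of B. This range is compact,
    and compactness lifts to the product by [compact_range_preimage]. *)
Lemma cob_mul A B : compact_open_bisection A -> compact_open_bisection B ->
  compact_open_bisection (bisection_mul A B).
Proof.
move=> cA cB; have [Ac Ao rA sA] := cA; have [Bc Bo rB sB] := cB.
have oAB := open_bisection_mul Ao Bo.
have rAB : set_inj (bisection_mul A B) range.
  move=> h h' /[!inE] -[g [f [Ag Bf /dr_compE[gf rh kh sh]]]].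
  move=> [g' [f' [Ag' Bf' /dr_compE[gf' rh' kh' sh']]]] r.
  have gg' : g = g' by apply: rA; rewrite ?inE// -rh -rh'.
  have ff' : f = f' by apply: rB; rewrite ?inE// -gf -gf' gg'.
  by apply: arrow_ext => //; rewrite ?kh ?kh' ?sh ?sh' ?gg' ?ff'.
split=> //; last first.
  move=> h h' /[!inE] -[g [f [Ag Bf /dr_compE[gf rh kh sh]]]].
  move=> [g' [f' [Ag' Bf' /dr_compE[gf' rh' kh' sh']]]] s.
  have ff' : f = f' by apply: sB; rewrite ?inE// -sh -sh'.
  have gg' : g = g' by apply: sA; rewrite ?inE// gf gf' ff'.
  by apply: arrow_ext => //; rewrite ?kh ?kh' ?rh ?rh' ?gg' ?ff'.
pose C := range @` (A `&` source @^-1` (range @` B)).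
have CE : C = range @` bisection_mul A B.
  apply/seteqP; split=> [_ [g [Ag [f Bf /esym gf]] <-]|_ [h [g [f [Ag Bf gf]]] <-]].
    have [h [hE _]] := dr_compP gf; exists h; first by exists g, f.
    by have [] := dr_compE hE.
  have [e -> _ _] := dr_compE gf.
  by exists g => //; split=> //; exists f.
have Cc : compact C.
  apply: continuous_compact; first exact/continuous_subspaceT/range_continuous.
  apply: compact_closedI => //; apply: preimage_closed.
    by move=> g _; exact: source_continuous.
  exact: (compact_closed (dr_hausdorff HDR) (cob_range_compact cB)).
rewrite (_ : bisection_mul A B = bisection_mul A B `&` range @^-1` C).
  by apply: compact_range_preimage => //; rewrite CE.
by apply/seteqP; split=> [h hAB|h []//]; split=> //; rewrite CE; exists h.
Qed.

End Bisections.

(** * Linear spans and the convolution product *)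

Section Span.
Variables (K : fieldType) (V : lmodType K).
Implicit Types (S P : set V).

Definition linear_set P := P 0 /\ forall a u v, P u -> P v -> P (a *: u + v).

Lemma linear_setZ P a u : linear_set P -> P u -> P (a *: u).
Proof. by move=> [P0 Pl] Pu; rewrite -[_ *: _]addr0; exact: Pl. Qed.

Lemma linear_setD P u v : linear_set P -> P u -> P v -> P (u + v).
Proof. by move=> [P0 Pl] Pu Pv; rewrite -[u]scale1r; exact: Pl. Qed.

Lemma linear_setB P u v : linear_set P -> P u -> P v -> P (u - v).
Proof. by move=> [P0 Pl] Pu Pv; rewrite addrC -scaleN1r; exact: Pl. Qed.

Lemma linear_set_sum P (I : Type) (s : seq I) (Q : pred I) (F : I -> V) :
  linear_set P -> (forall i, Q i -> P (F i)) -> P (\sum_(i <- s | Q i) F i).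
Proof.
move=> Pl PF; elim/big_ind: _ => //; first by case: Pl.
by move=> u v; exact: linear_setD.
Qed.

Lemma lspan_min S P : linear_set P -> S `<=` P -> lspan S `<=` P.
Proof.
move=> Pl SP _ [n [a [w [Sw ->]]]]; apply: linear_set_sum => // i _.
by apply: linear_setZ => //; exact: SP.
Qed.

Lemma sub_lspan S : S `<=` lspan S.
Proof.
move=> v Sv; exists 1%N, (fun=> 1), (fun=> v); split=> //.
by rewrite big_ord1 scale1r.
Qed.

Lemma lspan_linear S : linear_set (lspan S).
Proof.
split; first by exists 0%N, (fun=> 0), (fun=> 0); split; [case|rewrite big_ord0].
move=> c _ _ [n [a [w [Sw ->]]]] [m [b [z [Sz ->]]]].
pose glue (T : Type) (f : 'I_n -> T) (g : 'I_m -> T) (i : 'I_(n + m)) :=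
  match fintype.split i with inl j => f j | inr j => g j end.
exists (n + m)%N, (glue _ (fun i => c * a i) b), (glue _ w z).
split; first by move=> i; rewrite /glue; case: (fintype.split i).
have gl T f g j : glue T f g (lshift m j) = f j.
  by rewrite /glue -[lshift _ _]/(unsplit (inl j)) unsplitK.
have gr T f g j : glue T f g (rshift n j) = g j.
  by rewrite /glue -[rshift _ _]/(unsplit (inr j)) unsplitK.
rewrite big_split_ord; under eq_bigr do rewrite !gl.
under [X in _ = _ + X]eq_bigr do rewrite !gr.
rewrite scaler_sumr; congr (_ + _); by apply: eq_bigr => i _; rewrite scalerA.
Qed.

End Span.

Section Convolution.
Variables (K : fieldType) (X : topologicalType) (D : set X) (sigma : X -> X).
Local Notation G := (dr_groupoid D sigma).
Local Notation range := (@dr_range X D sigma).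
Local Notation source := (@dr_source X D sigma).
Local Notation conv := (convolution D sigma K).
Implicit Types (g h : G) (B : set G) (C : set X) (phi psi : G -> K^o).

Lemma lin_funE (T : Type) a (f1 f2 : T -> K^o) (x : T) :
  (a *: f1 + f2) x = a * f1 x + f2 x.
Proof. by []. Qed.

Lemma dr_comp_funr g f f' h : dr_comp g f h -> dr_comp g f' h -> f = f'.
Proof.
move=> /dr_compE[e1 r1 c1 s1] /dr_compE[e2 r2 c2 s2].
apply: arrow_ext; [by rewrite -e1 -e2| |by rewrite -s1 -s2].
by move: c1; rewrite c2 => /addrI.
Qed.

Lemma dr_comp_unitl h : dr_comp (unit_arrow D sigma (range h)) h h.
Proof.
split=> //; rewrite [dr_degree (unit_arrow _ _ _)]/dr_degree /= add0r.
by rewrite /dr_range /dr_degree /dr_source /=; case: (\val h) => -[].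
Qed.

Lemma dr_comp_unitr h : dr_comp h (unit_arrow D sigma (source h)) h.
Proof.
split=> //; rewrite [dr_degree (unit_arrow _ _ _)]/dr_degree /= addr0.
by rewrite /dr_range /dr_degree /dr_source /=; case: (\val h) => -[].
Qed.

(** Under this condition the sum that defines a convolution with [phi] on the
    left has finitely many nonzero terms, since the first factor of a
    factorization of h has the range of h. *)
Definition range_finite phi :=
  forall x, finite_set [set g | range g = x /\ phi g <> 0].

Lemma convolution_finite phi psi h (T : set G) :
  (forall g, range g = range h -> phi g <> 0 -> T g) ->
  conv phi psi h = \sum_(p \in [set p | dr_comp p.1 p.2 h] `&` fst @^-1` T)
                      phi p.1 * psi p.2.
Proof.
move=> HT; apply/esym/fsbig_widen; first exact: subIsetl.
move=> [g f] /= [gf nT]; apply: contrapT => phiK; apply: nT; split=> //=.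
apply: HT; first by have [_ ->] := dr_compE gf.
by move=> phi0; apply: phiK; rewrite phi0 mul0r.
Qed.

Lemma finite_factorizations h (T : set G) : finite_set T ->
  finite_set ([set p : G * G | dr_comp p.1 p.2 h] `&` fst @^-1` T).
Proof.
pose k g := (g, xget g [set f | dr_comp g f h]).
move=> /(finite_image k); apply: sub_finite_set => -[g f] /= [gf Tg].
exists g => //; rewrite /k; congr pair; case: xgetP => [f' _ gf'|/(_ f)].
  exact: dr_comp_funr gf' gf.
by move/(_ gf).
Qed.

Lemma convolution_linearl a phi1 phi2 psi : range_finite phi1 ->
  range_finite phi2 ->
  conv (a *: phi1 + phi2) psi = a *: conv phi1 psi + conv phi2 psi.
Proof.
move=> f1 f2; apply/funext => h.
pose T := [set g | range g = range h /\ phi1 g <> 0] `|`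
          [set g | range g = range h /\ phi2 g <> 0].
have Tf : finite_set T by rewrite finite_setU.
rewrite lin_funE.
rewrite !(@convolution_finite _ _ h T).
- rewrite mulr_fsumr -fsbig_split; last exact: finite_factorizations.
  apply: eq_fsbigr => p _ /=; rewrite mulrA -mulrDl; congr (_ * _).
- by right.
- by left.
- move=> g gh; have [e1|] := pselect (phi1 g = 0); last by left.
  have [e2|] := pselect (phi2 g = 0); last by right.
  rewrite lin_funE e1 e2 mulr0 addr0; exact.
Qed.

Lemma convolution_linearr a phi psi1 psi2 : range_finite phi ->
  conv phi (a *: psi1 + psi2) = a *: conv phi psi1 + conv phi psi2.
Proof.
move=> f; apply/funext => h.
pose T := [set g | range g = range h /\ phi g <> 0].
rewrite lin_funE.
rewrite !(@convolution_finite phi _ h T)//.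
rewrite mulr_fsumr -fsbig_split; last exact/finite_factorizations/f.
apply: eq_fsbigr => p _ /=; rewrite mulrCA -mulrDr; congr (_ * _).
Qed.

(** Indicators of sets of units act as cut-offs: on the left according to the
    range, on the right according to the source. *)
Lemma convolution_unitl C psi h :
  conv \1_(unit_arrow D sigma @` C) psi h = \1_C (range h) * psi h.
Proof.
rewrite /convolution -(fsbig_widen [set (unit_arrow D sigma (range h), h)]).
- rewrite fsbig_set1 /= !indicE; congr (_%:R * _); congr nat_of_bool.
  apply/idP/idP => /set_mem Ch; apply: mem_set; last by exists (range h).
  by case: Ch => x Cx /(congr1 range) /= e; rewrite -[range h]e.
- by move=> _ ->; exact: dr_comp_unitl.
- move=> [g f] /= [gf ne]; rewrite indicE.
  have [[x Cx xg]|Cg] := pselect ((unit_arrow D sigma @` C) g); last first.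
    by rewrite memNset// mul0r.
  case: ne; have [e r c s] := dr_compE gf; subst g.
  congr pair; first by rewrite r.
  by apply: arrow_ext; [rewrite -e r|rewrite c add0r|].
Qed.

Lemma convolution_unitr C phi h :
  conv phi \1_(unit_arrow D sigma @` C) h = phi h * \1_C (source h).
Proof.
rewrite /convolution -(fsbig_widen [set (h, unit_arrow D sigma (source h))]).
- rewrite fsbig_set1 /= !indicE; congr (_ * _%:R); congr nat_of_bool.
  apply/idP/idP => /set_mem Ch; apply: mem_set; last by exists (source h).
  by case: Ch => x Cx /(congr1 source) /= e; rewrite -[source h]e.
- by move=> _ ->; exact: dr_comp_unitr.
- move=> [g f] /= [gf ne]; rewrite [X in _ * X]indicE.
  have [[x Cx xf]|Cf] := pselect ((unit_arrow D sigma @` C) f); last first.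
    by rewrite memNset// mulr0.
  case: ne; have [e r c s] := dr_compE gf; subst f.
  congr pair; last by rewrite s.
  by apply: arrow_ext; [|rewrite c addr0|rewrite s].
Qed.

End Convolution.

(** * The graded algebra and its vanishing ideals *)

Section Indicator.
Variables (R : pzRingType) (T : Type).
Implicit Types (B : set T) (x : T).

Lemma indicT B x : B x -> \1_B x = 1 :> R.
Proof. by move=> Bx; rewrite indicE mem_set. Qed.

Lemma indicF B x : ~ B x -> \1_B x = 0 :> R.
Proof. by move=> Bx; rewrite indicE memNset. Qed.

End Indicator.

Section Steinberg.
Variables (K : fieldType) (X : topologicalType) (D : set X) (sigma : X -> X).
Local Notation G := (dr_groupoid D sigma).
Local Notation range := (@dr_range X D sigma).
Local Notation source := (@dr_source X D sigma).
Local Notation degree := (@dr_degree X D sigma).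
Local Notation unit := (unit_arrow D sigma).
Local Notation conv := (convolution D sigma K).
Local Notation A := (steinberg D sigma K).
Local Notation Ak := (steinberg_degree D sigma K).
Implicit Types (g h : G) (B : set G) (C Y : set X) (phi psi : G -> K^o).

Lemma steinberg_linear : linear_set A.
Proof. exact: lspan_linear. Qed.

Lemma steinberg_degree_linear k : linear_set (Ak k).
Proof. exact: lspan_linear. Qed.

Lemma steinberg_indic B : compact_open_bisection B -> A \1_B.
Proof. by move=> cB; apply: sub_lspan; exists B. Qed.

Lemma steinberg_range_finite phi : A phi -> range_finite phi.
Proof.
apply: lspan_min; first split.
- by move=> x; rewrite (_ : [set _ | _] = set0)// -subset0 => g [].
- move=> a u v fu fv x.
  apply: (@sub_finite_set _ _ ([set g | range g = x /\ u g <> 0] `|`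
                               [set g | range g = x /\ v g <> 0])).
    move=> g [gx]; rewrite lin_funE.
    have [->|] := pselect (u g = 0); last by left.
    by rewrite mulr0 add0r; right.
  by rewrite finite_setU; split.
- move=> _ [B [_ _ rB _] <-] x.
  have H g : range g = x /\ (\1_B : G -> K^o) g <> 0 -> range g = x /\ B g.
    by move=> [-> gB]; split=> //; apply: contrapT => nB; apply: gB; exact: indicF.
  have [[g0 /H[gx0 Bg0]]|n] :=
    pselect (exists g, range g = x /\ (\1_B : G -> K^o) g <> 0).
    apply: (@sub_finite_set _ _ [set g0]) => // g /H[gx Bg].
    by apply: rB; rewrite ?inE// gx gx0.
  by rewrite (_ : [set _ | _] = set0)// -subset0 => g Hg; apply: n; exists g.
Qed.

Lemma steinberg_degree_supp k phi :
  Ak k phi -> forall g, phi g <> 0 -> degree g = k.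
Proof.
apply: (@lspan_min _ _ _ [set f | forall g, f g <> 0 -> degree g = k]); first split.
- by [].
- move=> a u v fu fv g; rewrite lin_funE.
  have [->|/fu//] := pselect (u g = 0); have [->|/fv//] := pselect (v g = 0).
  by rewrite mulr0 addr0.
- move=> _ [B [_ Bk] <-] g gB; apply: Bk; apply: contrapT => nB; apply: gB.
  exact: indicF.
Qed.

Lemma sub_steinberg_degree k : Ak k `<=` A.
Proof.
apply: lspan_min; first exact: steinberg_linear.
by move=> _ [B [cB _] <-]; exact: steinberg_indic.
Qed.

Hypothesis HDR : deaconu_renault D sigma.

Lemma steinberg_degree_bounded phi : A phi ->
  exists N : nat, forall g, phi g <> 0 -> (`|degree g| <= N)%N.
Proof.
apply: (@lspan_min _ _ _ [set f : G -> K^o | exists N : nat,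
  forall g, f g <> 0 -> (`|degree g| <= N)%N]); first split.
- by exists 0%N.
- move=> a u v [N HN] [M HM]; exists (maxn N M) => g; rewrite lin_funE leq_max.
  have [->|/HN->//] := pselect (u g = 0).
  have [->|/HM->//] := pselect (v g = 0); last by rewrite orbT.
  by rewrite mulr0 addr0.
- move=> _ [B [Bc _ _ _] <-].
  have [|||E [N HN] BE] := @compact_sub_directed _ B
    [set E | exists N : nat, forall g, E g -> (`|degree g| <= N)%N] Bc.
  + by exists 0%N.
  + move=> E1 E2 [N1 H1] [N2 H2]; exists (maxn N1 N2) => g.
    by rewrite leq_max => -[/H1->//|/H2->]; rewrite orbT.
  + move=> g _; exists (degree @^-1` [set degree g]); last exact: degree_near.
    by exists `|degree g|%N => h ->.
  + exists N => g gB; apply: HN; apply: BE; apply: contrapT => nB; apply: gB.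
    exact: indicF.
Qed.

Definition homogeneous_part k phi : G -> K^o :=
  fun g => (degree g == k)%:R * phi g.

Lemma homogeneous_part_steinberg k phi : A phi -> Ak k (homogeneous_part k phi).
Proof.
have [Ak0 Akl] := steinberg_degree_linear k.
apply: (@lspan_min _ _ _ [set f | Ak k (homogeneous_part k f)]); first split => /=.
- rewrite (_ : homogeneous_part _ _ = 0)//; apply/funext => g.
  by rewrite /homogeneous_part mulr0.
- move=> a u v Au Av; have := Akl a _ _ Au Av.
  rewrite (_ : homogeneous_part k (a *: u + v) =
    a *: homogeneous_part k u + homogeneous_part k v)//.
  by apply/funext => g; rewrite /homogeneous_part !lin_funE mulrDr mulrCA.
- move=> _ [B cB <-]; apply: sub_lspan.
  exists (B `&` degree @^-1` [set k]).
    by split; [apply: cob_clopenI => //; exact: degree_clopen|exact: subIsetr].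
  apply/funext => g; rewrite /homogeneous_part.
  have [<-|/eqP gk] := eqVneq; last by rewrite mul0r indicF// => -[].
  by rewrite mul1r !indicE in_setI andb_idr// => _; apply: mem_set.
Qed.

(** Degrees are bounded on compact sets, so finitely many homogeneous parts
    suffice. *)
Lemma steinberg_homogeneous_sum phi : A phi ->
  exists ks : seq int, phi = \sum_(k <- ks) homogeneous_part k phi.
Proof.
move=> /steinberg_degree_bounded[N HN].
pose ks : seq int := [seq i%:Z - N%:Z | i <- iota 0 (N + N).+1].
exists ks; apply/funext => g.
rewrite fct_sumE /homogeneous_part -mulr_suml -natr_sum.
have [->|/HN gN] := pselect (phi g = 0); first by rewrite mulr0.
suff -> : (\sum_(k <- ks) nat_of_bool (degree g == k) = 1)%N by rewrite mul1r.
under eq_bigr => k _ do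
  rewrite (_ : nat_of_bool _ = if degree g == k then 1 else 0)%N//.
rewrite -big_mkcond /= sum1_count (eq_count (a2 := pred1 (degree g))); last first.
  by move=> k /=; rewrite eq_sym.
rewrite count_uniq_mem; last by rewrite map_inj_uniq ?iota_uniq// => i j; lia.
suff -> : degree g \in ks by [].
apply/mapP; exists `|(degree g + N%:Z)%R|%N; last by lia.
by rewrite mem_iota; lia.
Qed.

Lemma steinberg_conv phi psi : A phi -> A psi -> A (conv phi psi).
Proof.
move=> Aphi Apsi; have [A0 Al] := steinberg_linear.
have conv0 (f : G -> K^o) : conv 0 f = 0.
  by apply/funext => h; apply: fsbig1 => p _; rewrite mul0r.
have conv0r (f : G -> K^o) : conv f 0 = 0.
  by apply/funext => h; apply: fsbig1 => p _; rewrite mulr0.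
suff : A phi /\ A (conv phi psi) by case.
move: phi Aphi; apply: (@lspan_min _ _ _ [set f | A f /\ A (conv f psi)]).
  split; first by split=> //=; rewrite conv0.
  move=> a u v [Au Acu] [Av Acv]; split; first exact: Al.
  by rewrite /= convolution_linearl; [exact: Al|exact: steinberg_range_finite..].
move=> _ [B cB <-]; split; first exact: steinberg_indic.
move: psi Apsi; apply: (@lspan_min _ _ _ [set f | A (conv \1_B f)]).
  split=> /=; first by rewrite conv0r.
  move=> a u v Au Av; rewrite convolution_linearr; first exact: Al.
  exact/steinberg_range_finite/steinberg_indic.
move=> _ [B' cB' <-] /=; rewrite convolution_indic//.
exact/steinberg_indic/cob_mul.
Qed.

Definition vanishing_ideal Y : set (G -> K^o) :=
  [set phi | A phi /\ forall g, Y (range g) -> phi g = 0].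

Definition invariant_set Y := forall g, Y (range g) <-> Y (source g).

Lemma vanishing_graded_ideal Y : invariant_set Y ->
  graded_ideal conv A Ak (vanishing_ideal Y).
Proof.
move=> Yinv; have [A0 Al] := steinberg_linear.
have Jl : linear_set (vanishing_ideal Y).
  split; first by split.
  move=> a u v [Au Yu] [Av Yv]; split; first exact: Al.
  by move=> g Yg; rewrite lin_funE Yu// Yv// mulr0 addr0.
split; first split.
- by split; [move=> phi []|case: Jl..].
- move=> phi psi Aphi [Apsi Yx]; split; split.
  + exact: steinberg_conv.
  + move=> h Yh; apply: fsbig1 => -[g f] /= /dr_compE[e r _ _].
    by rewrite Yx ?mulr0// -e; apply/Yinv; rewrite -r.
  + exact: steinberg_conv.
  + move=> h Yh; apply: fsbig1 => -[g f] /= /dr_compE[e r _ _].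
    by rewrite Yx ?mul0r// -r.
- split.
  apply/seteqP; split; last by apply: lspan_min => // phi [k _ []].
  move=> phi [Aphi Yphi]; have [ks ->] := steinberg_homogeneous_sum Aphi.
  apply: linear_set_sum; first exact: lspan_linear.
  move=> k _; apply: sub_lspan; exists k => //.
  have Hk := homogeneous_part_steinberg k Aphi.
  split=> //; split; first exact: sub_steinberg_degree Hk.
  by move=> g /Yphi gY; rewrite /homogeneous_part gY mulr0.
  move=> ks x uks xJ s0 k kks; apply/funext => g; apply: contrapT => gk.
  have {}gk : x k g <> 0 by [].
  have [xkA _] := xJ k; have gE := steinberg_degree_supp xkA gk.
  move/(congr1 (fun f : G -> K^o => f g)) : s0; rewrite fct_sumE.
  rewrite (bigD1_seq k)//= big1 ?addr0// => j jk; apply: contrapT => gj.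
  have [xjA _] := xJ j; have := steinberg_degree_supp xjA gj.
  by rewrite gE => kj; move: jk; rewrite kj eqxx.
Qed.

End Steinberg.

(** * Graded ideals over a minimal groupoid *)

Section MinimalIdeals.
Variables (K : fieldType) (X : topologicalType) (D : set X) (sigma : X -> X).
Local Notation G := (dr_groupoid D sigma).
Local Notation range := (@dr_range X D sigma).
Local Notation source := (@dr_source X D sigma).
Local Notation degree := (@dr_degree X D sigma).
Local Notation unit := (unit_arrow D sigma).
Local Notation conv := (convolution D sigma K).
Local Notation A := (steinberg D sigma K).
Local Notation Ak := (steinberg_degree D sigma K).
Implicit Types (g h : G) (B L : set G) (C U V : set X) (phi psi : G -> K^o).

Hypothesis HDR : deaconu_renault D sigma.

(** An arrow h of degree k other than g differs from g in its range or in its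
    source, and these can be separated in the Hausdorff space X. Compactness
    makes the separation uniform on L. *)
Lemma homogeneous_compact_separated k L g : compact L ->
  L `<=` degree @^-1` [set k] -> degree g = k -> ~ L g ->
  exists U V, [/\ nbhs (range g) U, nbhs (source g) V &
    forall h, L h -> U (range h) -> ~ V (source h)].
Proof.
move=> Lc Lk gk nLg.
pose sep E := exists U V, [/\ nbhs (range g) U, nbhs (source g) V &
    forall h, E h -> U (range h) -> ~ V (source h)].
have [|||E [U [V [nU nV HE]]] LE] := @compact_sub_directed _ L sep Lc; last first.
  by exists U, V; split=> // h /LE; exact: HE.
- move=> h Lh; have [rgh|rgh] := pselect (range g = range h); last first.
    have [U [V [oU oV Ug Vh UV]]] := hausdorff_sep (dr_hausdorff HDR) rgh.
    exists (range @^-1` V); last first.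
      by apply: (range_continuous HDR); exact: open_nbhs_nbhs.
    exists U, setT; split; [exact: open_nbhs_nbhs|exact: filterT|].
    by move=> h' Vh' Uh'; move: UV; rewrite -subset0 => /(_ (range h')); case.
  have sgh : source g <> source h.
    move=> sgh; apply: nLg; rewrite (_ : g = h)//.
    by apply: arrow_ext => //; rewrite gk (Lk _ Lh).
  have [U [V [oU oV Ug Vh UV]]] := hausdorff_sep (dr_hausdorff HDR) sgh.
  exists (source @^-1` V); last first.
    by apply: (source_continuous HDR); exact: open_nbhs_nbhs.
  exists setT, U; split; [exact: filterT|exact: open_nbhs_nbhs|].
  by move=> h' Vh' _ Uh'; move: UV; rewrite -subset0 => /(_ (source h')); case.
- move=> E1 E2 [U1 [V1 [nU1 nV1 H1]]] [U2 [V2 [nU2 nV2 H2]]].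
  exists (U1 `&` U2), (V1 `&` V2); split; [exact: filterI..|].
  by move=> h [/H1 H|/H2 H] [? ?] [? ?]; apply: H.
- by exists setT, setT; split; [exact: filterT..|].
Qed.

(** For phi = 1_B' the two functions can only differ on B \ B' and on B' \ B when
    g is in B', and on B' when it is not; these sets are compact and do not
    contain g. The property is linear in phi. *)
Lemma homogeneous_locally_indic k phi B g : Ak k phi ->
  compact_open_bisection B -> B `<=` degree @^-1` [set k] -> B g ->
  exists U V, [/\ nbhs (range g) U, nbhs (source g) V &
    forall h, U (range h) -> V (source h) -> phi h = phi g * \1_B h].
Proof.
move=> Akphi cB Bk Bg; move: phi Akphi.
apply: (@lspan_min _ _ _ [set phi : G -> K^o | exists U V,
  [/\ nbhs (range g) U, nbhs (source g) V &
    forall h, U (range h) -> V (source h) -> phi h = phi g * \1_B h]]).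
  split.
    exists setT, setT; split; [exact: filterT..|].
    by move=> h _ _; rewrite mul0r.
  move=> a u v [U1 [V1 [nU1 nV1 H1]]] [U2 [V2 [nU2 nV2 H2]]].
  exists (U1 `&` U2), (V1 `&` V2); split; [exact: filterI..|].
  move=> h [? ?] [? ?]; rewrite !lin_funE (H1 h)// (H2 h)//.
  by rewrite mulrDl mulrA.
move=> _ [B' [cB' B'k] <-]; have [Bc Bo _ _] := cB; have [B'c B'o _ _] := cB'.
have gk : degree g = k by exact: Bk.
have [B'g|nB'g] := pselect (B' g); last first.
  have [U [V [nU nV H]]] := homogeneous_compact_separated B'c B'k gk nB'g.
  exists U, V; split=> // h Uh Vh; rewrite (indicF _ nB'g) mul0r indicF//.
  by move=> /H/(_ Uh).
have diff L1 L2 : compact L1 -> open L2 -> L1 `<=` degree @^-1` [set k] -> L2 g ->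
    exists U V, [/\ nbhs (range g) U, nbhs (source g) V &
    forall h, (L1 `\` L2) h -> U (range h) -> ~ V (source h)].
  move=> L1c L2o L1k L2g; apply: (@homogeneous_compact_separated k) => //.
  - by rewrite setDE; apply: compact_closedI => //; rewrite closedC.
  - by move=> h [/L1k].
  - by move=> [].
have [U1 [V1 [nU1 nV1 H1]]] := diff _ _ Bc B'o Bk B'g.
have [U2 [V2 [nU2 nV2 H2]]] := diff _ _ B'c Bo B'k Bg.
exists (U1 `&` U2), (V1 `&` V2); split; [exact: filterI..|].
move=> h [Uh1 Uh2] [Vh1 Vh2]; rewrite (indicT _ B'g) mul1r.
have [Bh|nBh] := pselect (B h); have [B'h|nB'h] := pselect (B' h).
- by rewrite !indicT.
- by case: (H1 h).
- by case: (H2 h).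
- by rewrite !indicF.
Qed.

Hypothesis Xtd : totally_disconnected [set: X].

Variable J : set (G -> K^o).
Hypothesis Jideal : two_sided_ideal conv A J.

Lemma ideal_linear : linear_set J.
Proof. by have [[_ ? ?] _] := Jideal. Qed.

Lemma sub_ideal : J `<=` A.
Proof. by have [[]] := Jideal. Qed.

Lemma ideal_homogeneous_indic k phi g : Ak k phi -> J phi -> phi g <> 0 ->
  exists B, [/\ compact_open_bisection B, B g & J \1_B].
Proof.
move=> kphi Jphi /eqP gphi.
have gk : degree g = k by apply: steinberg_degree_supp kphi _ _; exact/eqP.
have [|B [cB Bg Bk]] := cob_base HDR Xtd (g := g) (N := degree @^-1` [set k]).
  by have := degree_near HDR g; apply: filterS => h /= ->.
have [U [V [nU nV HUV]]] := homogeneous_locally_indic kphi cB Bk Bg.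
have cnb := compact_open_nbhs (dr_hausdorff HDR) (dr_locally_compact HDR) Xtd.
have [U' [cU' oU' Ug UU']] := cnb _ _ nU.
have [V' [cV' oV' Vg VV']] := cnb _ _ nV.
have clop C : compact C -> open C -> clopen C.
  by move=> Cc Co; split=> //; exact: (compact_closed (dr_hausdorff HDR)).
pose B' := B `&` (range @^-1` U' `&` source @^-1` V').
have cB' : compact_open_bisection B'.
  apply: cob_clopenI => //.
  have [oU1 cU1] := clop _ cU' oU'; have [oV1 cV1] := clop _ cV' oV'.
  split; [apply: openI|apply: closedI].
  - by move/continuousP: (range_continuous HDR); exact.
  - by move/continuousP: (source_continuous HDR); exact.
  - by apply: preimage_closed => // h _; exact: range_continuous.
  - by apply: preimage_closed => // h _; exact: source_continuous.
exists B'; split=> //.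
have AU : A \1_(unit @` U') by apply: steinberg_indic; exact: cob_units.
have AV : A \1_(unit @` V') by apply: steinberg_indic; exact: cob_units.
have [_ Jm] := Jideal.
have [Jcut _] := Jm _ _ AU (Jm _ _ AV Jphi).2.
rewrite (_ : \1_B' = (phi g)^-1 *: conv \1_(unit @` U') (conv phi \1_(unit @` V'))).
  exact: linear_setZ ideal_linear Jcut.
apply/funext => h.
have -> : ((phi g)^-1 *: conv \1_(unit @` U') (conv phi \1_(unit @` V'))) h =
  (phi g)^-1 * conv \1_(unit @` U') (conv phi \1_(unit @` V')) h by [].
rewrite convolution_unitl convolution_unitr.
have [Uh|nUh] := pselect (U' (range h)); last first.
  by rewrite (indicF _ nUh) mul0r mulr0 indicF// => -[_ []].
have [Vh|nVh] := pselect (V' (source h)); last first.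
  by rewrite (indicF _ nVh) !mulr0 indicF// => -[_ []].
rewrite (indicT _ Uh) (indicT _ Vh) mul1r mulr1 (HUV h); [|exact: UU'|exact: VV'].
rewrite mulrA mulVf// mul1r.
have [Bh|nBh] := pselect (B h); first by rewrite !indicT.
by rewrite !indicF// => -[].
Qed.

(** This is 1_(B^-1) * 1_B = 1_(s(B)). *)
Lemma ideal_source_units B : compact_open_bisection B -> J \1_B ->
  J \1_(unit @` (source @` B)).
Proof.
move=> cB JB; have [_ Jm] := Jideal.
have ciB := cob_inv HDR cB.
have [Jc _] := Jm _ _ (steinberg_indic K ciB) JB.
move: Jc; rewrite convolution_indic//.
rewrite (_ : bisection_mul _ _ = unit @` (source @` B))//.
have [_ _ rB _] := cB.
apply/seteqP; split.
  move=> h [_ [f [[g Bg <-] Bf /dr_compE[e rh kh sh]]]].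
  have gf : g = f by apply: rB; rewrite ?inE//.
  exists (source f); first by exists f.
  subst g; apply: arrow_ext; first by rewrite rh.
    rewrite kh; apply/esym; exact: addNr.
  by rewrite sh.
move=> _ [_ [g Bg <-] <-]; exists (inv_arrow g), g; split=> //.
split=> //; rewrite [dr_degree (inv_arrow _)]/dr_degree /=.
by rewrite addNr.
Qed.

(** The set S = s(B) of [ideal_source_units] is open, so the orbit of u meets it:
    there is an arrow a from u to a point of S. For a small bisection N around
    a, 1_N = 1_S * 1_N lies in J, and s(N) is the required neighbourhood. *)
Lemma ideal_units_nbhs (u : X) : dr_minimal D sigma -> graded_ideal conv A Ak J ->
  J <> [set 0] -> exists2 C, J \1_(unit @` C) & nbhs u C.
Proof.
move=> Dmin [_ [JE _]] J0.
have [k [phi [kphi Jphi phi0]]] : exists k phi, [/\ Ak k phi, J phi & phi <> 0].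
  apply: contrapT => n; apply: J0; apply/seteqP; split; last first.
    by move=> _ ->; case: ideal_linear.
  rewrite {1}JE; apply: lspan_min.
    by split=> // a _ _ -> ->; rewrite /= scaler0 addr0.
  move=> phi [k _ [kphi Jphi]]; apply: contrapT => phi0; apply: n.
  by exists k, phi.
have [g gphi] : exists g, phi g <> 0.
  apply: contrapT => n; apply: phi0; apply/funext => g; apply: contrapT => gphi.
  by apply: n; exists g.
have [B [cB Bg JB]] := ideal_homogeneous_indic kphi Jphi gphi.
have oS : open (source @` B) by exact: cob_source_open.
have [|x [Sx [a au ax]]] := Dmin u _ _ oS; last subst x.
  by exists (source g); exists g.
have [|N [cN Na NS]] := cob_base HDR Xtd (g := a) (N := range @^-1` (source @` B)).
  by apply: (range_continuous HDR); exact: open_nbhs_nbhs.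
have JN : J \1_N.
  have [_ /(_ _ _ (steinberg_indic K cN) (ideal_source_units cB JB))[_]] := Jideal.
  rewrite (_ : conv _ _ = \1_N)//; apply/funext => h; rewrite convolution_unitl.
  have [Nh|nNh] := pselect (N h); last by rewrite (indicF _ nNh) mulr0.
  by rewrite !indicT ?mul1r//; exact: NS.
exists (source @` N); first exact: ideal_source_units.
by apply: open_nbhs_nbhs; split; [exact: cob_source_open|exists a].
Qed.

Lemma minimal_graded_ideal : dr_minimal D sigma -> graded_ideal conv A Ak J ->
  J <> [set 0] -> J = A.
Proof.
move=> Dmin gJ J0; have [_ Jm] := Jideal.
apply/seteqP; split; first exact: sub_ideal.
apply: lspan_min; first exact: ideal_linear.
move=> _ [B cB <-].
have [|||C JC BC] := @compact_sub_directed _ (range @` B) [set C | J \1_(unit @` C)]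
  (cob_range_compact HDR cB).
- rewrite /= image_set0 (_ : \1_set0 = 0); first by case: ideal_linear.
  by apply/funext => g; rewrite indicF.
- move=> C1 C2 /= J1 J2.
  (* inclusion-exclusion, the product being the indicator of the intersection *)
  rewrite (_ : \1_(unit @` (C1 `|` C2)) = \1_(unit @` C1) + \1_(unit @` C2)
     - conv \1_(unit @` C1) \1_(unit @` C2) :> (G -> K^o)); last first.
    apply/funext => h; rewrite !fctE convolution_unitl.
    have un C x : (unit @` C) (unit x) <-> C x.
      by split=> [[y Cy /(congr1 range) /= e]|Cx]; [rewrite -[x]e|exists x].
    have [[x hx]|nh] := pselect (exists x, h = unit x); last first.
      have nu C : ~ (unit @` C) h by move=> [x _ hx]; apply: nh; exists x.
      by rewrite !(indicF _ (nu _)) mulr0 addr0 subr0.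
    subst h; have -> : range (unit x) = x by [].
    have iu C : \1_(unit @` C) (unit x) = \1_C x :> K.
      rewrite !indicE; congr (_%:R); congr nat_of_bool.
      by apply/idP/idP => /set_mem Cx; apply: mem_set; apply/un.
    rewrite !iu.
    have [C1x|nC1x] := pselect (C1 x).
      rewrite (indicT _ C1x) indicT; last by left.
      by rewrite mul1r addrK.
    rewrite (indicF _ nC1x) mul0r subr0 add0r.
    have [C2x|nC2x] := pselect (C2 x); first by rewrite !indicT//; right.
    by rewrite !indicF// => -[].
  apply: linear_setB; first exact: ideal_linear.
    by apply: linear_setD => //; exact: ideal_linear.
  by have [] := Jm _ _ (sub_ideal J1) J2.
- by move=> u _; exact: ideal_units_nbhs.
rewrite (_ : \1_B = conv \1_(unit @` C) \1_B).
  by have [] := Jm _ _ (steinberg_indic K cB) JC.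
apply/funext => h; rewrite convolution_unitl.
have [Bh|nBh] := pselect (B h); last by rewrite (indicF _ nBh) mulr0.
by rewrite !indicT ?mul1r//; apply: BC; exists h.
Qed.

End MinimalIdeals.

(** * Orbits that are not dense *)

Section FiniteCodimension.
Variables (K : fieldType) (X : topologicalType) (D : set X) (sigma : X -> X).
Local Notation G := (dr_groupoid D sigma).
Local Notation range := (@dr_range X D sigma).
Local Notation source := (@dr_source X D sigma).
Local Notation degree := (@dr_degree X D sigma).
Local Notation unit := (unit_arrow D sigma).
Local Notation conv := (convolution D sigma K).
Local Notation A := (steinberg D sigma K).
Local Notation Ak := (steinberg_degree D sigma K).
Local Notation vanishing := (@vanishing_ideal K X D sigma).
Implicit Types (g h : G) (B : set G) (Y : set X) (u : X).

Hypothesis HDR : deaconu_renault D sigma.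

Lemma dr_groupoid_accessible : accessible_space G.
Proof.
move=> g h /eqP gh; suff : nbhs g (~` [set h]).
  rewrite nbhsE => -[N [oN Ng] Nh]; exists N; split=> //; rewrite inE// => Nh'.
  exact: (Nh h).
have sepX (x y : X) : x <> y -> nbhs x (~` [set y]).
  move=> xy; apply: open_nbhs_nbhs; split; last exact: xy.
  rewrite openC; apply/accessible_closed_set1/hausdorff_accessible.
  exact: dr_hausdorff HDR.
have [r|/sepX r] := pselect (range g = range h); last first.
  have : nbhs g (range @^-1` ~` [set range h]) by exact: (range_continuous HDR).
  by apply: filterS => h' /= + hh; apply; rewrite hh.
have [s|/sepX s] := pselect (source g = source h); last first.
  have : nbhs g (source @^-1` ~` [set source h]) by exact: (source_continuous HDR).
  by apply: filterS => h' /= + hh; apply; rewrite hh.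
have := degree_near HDR g; apply: filterS => h' /= + h'h; rewrite h'h => d.
by apply: gh; apply: arrow_ext.
Qed.

Lemma lspan_seqP (V : lmodType K) (b : seq V) w : lspan [set` b] w ->
  exists c : 'I_(size b) -> K, w = \sum_l c l *: b`_l.
Proof.
apply: (@lspan_min _ _ _
  [set w | exists c : 'I_(size b) -> K, w = \sum_l c l *: b`_l]).
  split.
    by exists (fun=> 0); rewrite big1// => l _; rewrite scale0r.
  move=> a _ _ [c1 ->] [c2 ->]; exists (fun l => a * c1 l + c2 l).
  rewrite scaler_sumr -big_split; apply: eq_bigr => l _ /=.
  by rewrite scalerDl scalerA.
move=> v /= vb; have lt : (index v b < size b)%N by rewrite index_mem.
exists (fun l => (l == Ordinal lt)%:R).
rewrite (bigD1 (Ordinal lt))//= eqxx scale1r nth_index// big1 ?addr0// => l.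
by move=> /negbTE ->; rewrite scale0r.
Qed.

Hypothesis Xtd : totally_disconnected [set: X].

(** A rank argument. If [b] spans A modulo the ideal and has n elements, then for
    n + 1 arrows over Y the indicators of bisections that isolate one arrow from
    the others give a factorization of the identity matrix of size n + 1 through
    dimension n. *)
Lemma finite_codim_finite_arrows Y : finite_codim A (vanishing Y) ->
  finite_set [set g | Y (range g)].
Proof.
move=> [b bA bspan]; apply: contrapT => /(@infinite_set_fset _ _ (size b).+1).
move=> [F FY Fb]; pose n := size b.
have [g0 _] : exists g0, g0 \in F.
  by apply/fset0Pn; rewrite -cardfs_gt0; exact: leq_trans Fb.
pose g (i : 'I_n.+1) : G := nth g0 F i.
have ltF (i : 'I_n.+1) : (i < size F)%N by apply: leq_trans Fb.
have gF i : g i \in F by exact: mem_nth.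
have ginj : injective g.
  by move=> i j /eqP; rewrite nth_uniq ?fset_uniq// => /eqP/val_inj.
have dual i : exists c : 'I_n -> K,
    forall j, \sum_l c l * (b`_l : G -> K^o) (g j) = (i == j)%:R.
  have [|B [cB Bg Bo]] := cob_base HDR Xtd (g := g i)
      (N := ~` (g @` [set j | j != i])).
    apply: open_nbhs_nbhs; split; last first.
      by move=> [j /= ji /ginj e]; rewrite e eqxx in ji.
    rewrite openC; apply: (accessible_finite_set_closed.1 dr_groupoid_accessible).
    exact/finite_image/finite_finset.
  have [w /lspan_seqP[c wE] [_ Yw]] := bspan _ (steinberg_indic K cB).
  exists c => j; have /Yw : Y (range (g j)) by exact: FY (gF j).
  have -> : (\1_B - w) (g j) = \1_B (g j) - w (g j) by [].
  move/eqP; rewrite subr_eq0 => /eqP; rewrite wE fct_sumE => <-.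
  have [<-|ij] := eqVneq i j; first by rewrite indicT.
  by rewrite indicF// => /Bo; apply; exists j; rewrite //= eq_sym.
have [c cE] := choice dual.
have : \matrix_(i, l) c i l *m
    \matrix_(l < n, j < n.+1) (b`_l : G -> K^o) (g j) = 1%:M.
  apply/matrixP => i j; rewrite !mxE -cE; apply: eq_bigr => l _.
  by rewrite !mxE.
move=> M1; have := mxrank1 K n.+1; rewrite -M1 => rk.
have := leq_trans (mulmx_max_rank (\matrix_(i, l) c i l)
  (\matrix_(l < n, j < n.+1) (b`_l : G -> K^o) (g j))) (leqnn n).
by rewrite rk ltnn.
Qed.

Lemma orbit_invariant u : invariant_set D sigma (dr_orbit D sigma u).
Proof.
move=> g; split=> -[h hu hE].
  have [k [/dr_compE[_ rk _ sk] _]] : exists! k, dr_comp (inv_arrow g) h k.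
    by apply: dr_compP; rewrite hE.
  by exists k; [rewrite /= sk|rewrite rk].
have [k [/dr_compE[_ rk _ sk] _]] : exists! k, dr_comp g h k by exact: dr_compP.
by exists k; [rewrite /= sk|].
Qed.

Lemma orbit_refl u : dr_orbit D sigma u u.
Proof. by exists (unit u). Qed.

Lemma invariant_setC Y : invariant_set D sigma Y ->
  invariant_set D sigma (~` Y).
Proof. by move=> Yinv g; split=> nY /Yinv. Qed.

Lemma not_dense_vanishing_ideal_neq0 Y : ~ dense Y -> vanishing Y <> [set 0].
Proof.
move=> nd J0; apply: nd => O [x Ox] oO; apply: contrapT => OY.
have [|B [cB Bx BO]] := cob_base HDR Xtd (g := unit x) (N := range @^-1` O).
  by apply: (range_continuous HDR); exact: open_nbhs_nbhs.
have : vanishing Y \1_B.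
  split; first exact: steinberg_indic.
  by move=> g Yg; apply: indicF => /BO Og; apply: OY; exists (range g).
rewrite J0 => /(congr1 (fun f : G -> K^o => f (unit x))).
rewrite indicT// => /eqP; exact/negP/oner_neq0.
Qed.

Lemma vanishing_ideal_neq_steinberg Y u : Y u -> vanishing Y <> A.
Proof.
move=> Yu JA; have [B [cB Bu _]] := cob_base HDR Xtd (g := unit u) filterT.
have : vanishing Y \1_B by rewrite JA; exact: steinberg_indic.
move=> [_ /(_ (unit u) Yu)]; rewrite indicT// => /eqP; exact/negP/oner_neq0.
Qed.

Lemma graded_simple_minimal : graded_simple conv A Ak -> dr_minimal D sigma.
Proof.
move=> simple u; apply: contrapT => nd.
have [/(not_dense_vanishing_ideal_neq0 nd)//|] :=
  simple _ (vanishing_graded_ideal K HDR (orbit_invariant u)).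
by apply: vanishing_ideal_neq_steinberg; exact: orbit_refl.
Qed.

(** Together with the next lemma: isolation spreads from the source of an arrow
    to the arrow, because the source map is locally injective, and from there to
    the range, because the range map is open. *)
Lemma isolated_source_arrow g : nbhs (source g) [set source g] -> nbhs g [set g].
Proof.
move=> iso; have [B [[_ oB _ sB] Bg _]] := cob_base HDR Xtd (g := g) filterT.
have : nbhs g (B `&` source @^-1` [set source g]).
  by apply: filterI; [exact: open_nbhs_nbhs|exact: (source_continuous HDR)].
by apply: filterS => h [Bh sh]; apply: sB; rewrite ?inE.
Qed.

Lemma isolated_source_range g : nbhs (source g) [set source g] ->
  nbhs (range g) [set range g].
Proof.
by move=> /isolated_source_arrow/(range_open HDR); rewrite image_set1.
Qed.

(** If all iterates were defined at u, the arrows (u, n, sigma^n u) would have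
    infinitely many degrees. *)
Lemma finite_arrows_exit u :
  finite_set [set g | dr_orbit D sigma u (range g)] ->
  exists m, dom_iter D sigma m u /\ ~ D (iter m sigma u).
Proof.
move=> Yfin; apply: contrapT => nexit.
have dn n : dom_iter D sigma n u.
  elim: n => //= n IH; split=> //; apply: contrapT => nD; apply: nexit.
  by exists n.
apply: infinite_nat; move: Yfin => /(finite_image degree) Tfin.
apply: sub_finite_set (finite_preimage _ Tfin); last first.
  by move=> i j _ _ e; exact: (congr1 absz e : `|i%:Z|%N = `|j%:Z|%N).
move=> n _; have [g [[gn _ _ _] rg sg]] :=
  @lag_of X D sigma u n 0 (iter n sigma u) (dn n) I erefl.
exists g; first by exists (unit u); rewrite //= rg.
by rewrite gn subr0.
Qed.

(** There is an arrow with range u and source sigma^m u. *)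
Lemma exit_isolated u m : dom_iter D sigma m u ->
  nbhs (iter m sigma u) [set iter m sigma u] -> nbhs u [set u].
Proof.
move=> dm iso; have [g [_ rg sg]] :=
  @lag_of X D sigma u m 0 (iter m sigma u) dm I erefl.
by rewrite -rg; apply: isolated_source_range; rewrite sg.
Qed.

(** The ideal of the elements supported on the finitely many arrows over Y is
    spanned by the point masses, which are in A as these arrows are isolated.
    Its codimension being finite too, A is finite-dimensional. *)
Lemma finite_arrows_steinberg_finite_dim Y :
  (forall g, Y (range g) -> nbhs g [set g]) ->
  finite_set [set g | Y (range g)] ->
  finite_codim A (vanishing (~` Y)) -> finite_dim A.
Proof.
move=> iso Yfin [b bA bspan]; pose T := [set g | Y (range g)].
pose delta g : G -> K^o := \1_[set g].
have deltaA g : Y (range g) -> A (delta g).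
  move=> Yg; apply: steinberg_indic; split.
  - exact: compact_set1.
  - by rewrite openE => _ ->; exact: iso.
  - by move=> h k /[!inE] -> ->.
  - by move=> h k /[!inE] -> ->.
pose s : seq G := fset_set T.
exists (b ++ [seq delta g | g <- s]); apply/seteqP; split; last first.
  apply: lspan_min; first exact: lspan_linear.
  move=> phi /=; rewrite mem_cat => /orP[/bA//|/mapP[g]].
  by rewrite in_fset_set// inE => /deltaA + ->.
move=> phi Aphi; have [w wb [_ wY]] := bspan _ Aphi.
have Sl := @lspan_linear K (G -> K^o) [set` b ++ [seq delta g | g <- s]].
rewrite -(subrK w phi); apply: linear_setD => //; last first.
  apply: lspan_min wb => // v vb; apply: sub_lspan => /=.
  by rewrite mem_cat (vb : v \in b).
have -> : phi - w = \sum_(g <- s) (phi - w) g *: delta g.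
  apply/funext => h; rewrite fct_sumE.
  have [hT|nhT] := pselect (T h); last first.
    rewrite wY// big1_seq// => g /andP[_ gs].
    have -> : ((phi - w) g *: delta g) h = (phi - w) g * delta g h by [].
    rewrite /delta indicF ?mulr0// => hg; apply: nhT; rewrite hg.
    by move: gs; rewrite in_fset_set// inE.
  have hs : h \in s by rewrite in_fset_set// inE.
  rewrite (bigD1_seq h)//=; last exact: fset_uniq.
  have -> : ((phi - w) h *: delta h) h = (phi - w) h * delta h h by [].
  rewrite /delta indicT// mulr1 big1 ?addr0// => g gh.
  have -> : ((phi - w) g *: \1_[set g]) h =
    (phi - w) g * (\1_[set g] : G -> K^o) h by [].
  by rewrite indicF ?mulr0// => hg; rewrite hg eqxx in gh.
rewrite big_seq; apply: linear_set_sum => // g gs.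
apply: linear_setZ => //; apply: sub_lspan => /=.
by rewrite mem_cat map_f ?orbT.
Qed.

Lemma graded_just_infinite_minimal :
  (forall x : X, ~ D x -> isolated [set: X] x) ->
  graded_just_infinite conv A Ak -> dr_minimal D sigma.
Proof.
move=> Disol [Ainf jinf] u; apply: contrapT => nd.
pose Y := dr_orbit D sigma u.
have Yinv : invariant_set D sigma Y by exact: orbit_invariant.
have Yfin : finite_set [set g | Y (range g)].
  apply: finite_codim_finite_arrows; apply: jinf; first exact: vanishing_graded_ideal.
  exact: not_dense_vanishing_ideal_neq0.
have [m [dm /Disol[_ [V nV VE]]]] := finite_arrows_exit Yfin.
rewrite setIT in VE; rewrite VE in nV.
have isou := exit_isolated dm nV.
have isoY y : Y y -> nbhs y [set y].
  by move=> [g gu <-]; apply: isolated_source_range; rewrite gu.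
have iso g : Y (range g) -> nbhs g [set g].
  by move=> /Yinv/isoY/isolated_source_arrow.
apply: Ainf; apply: (finite_arrows_steinberg_finite_dim iso Yfin).
apply: jinf; first exact: (vanishing_graded_ideal K HDR (invariant_setC Yinv)).
apply: not_dense_vanishing_ideal_neq0 => dY.
have uo : open [set u] by rewrite openE => _ ->.
have [_ [/= -> nYu]] := dY _ (ex_intro _ u erefl) uo.
by apply: nYu; exact: orbit_refl.
Qed.

Lemma minimal_graded_just_infinite : ~ finite_dim A -> dr_minimal D sigma ->
  graded_just_infinite conv A Ak.
Proof.
move=> Ainf Dmin; split=> // J gJ J0; have [iJ _] := gJ.
rewrite (minimal_graded_ideal HDR Xtd iJ Dmin gJ J0).
have [A0 Al] := steinberg_linear K D sigma.
exists [::] => // v Av; exists 0.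
  by case: (@lspan_linear K (G -> K^o) [set` [::]]).
by rewrite subr0.
Qed.

Lemma minimal_graded_simple : dr_minimal D sigma -> graded_simple conv A Ak.
Proof.
move=> Dmin J gJ; have [iJ _] := gJ.
have [|J0] := pselect (J = [set 0]); first by left.
by right; exact: (minimal_graded_ideal HDR Xtd iJ Dmin gJ J0).
Qed.

End FiniteCodimension.

Theorem theorem6p16 (K : fieldType) (X : topologicalType) (D : set X)
  (sigma : X -> X)
  (HDR : deaconu_renault D sigma)
  (Xtd : totally_disconnected [set: X])
  (Ainf : ~ finite_dim (steinberg D sigma K))
  (Disol : forall x : X, ~ D x -> isolated [set: X] x) :
  [<-> graded_just_infinite (convolution D sigma K) (steinberg D sigma K)
         (steinberg_degree D sigma K);
       graded_simple (convolution D sigma K) (steinberg D sigma K)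
         (steinberg_degree D sigma K);
       dr_minimal D sigma].
Proof.
tfae.
- move=> /(graded_just_infinite_minimal HDR Xtd Disol).
  exact: minimal_graded_simple.
- exact: graded_simple_minimal.
- exact: minimal_graded_just_infinite.
Qed.
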